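(* Let $b,c$ be positive integers and let $\mathcal{A}=\mathcal{A}(b,c)$ be the coefficient-free rank 2 cluster algebra. (a) For each $(a_1,a_2)\in\mathbb{Z}^2$ there exists a (unique) greedy element $x[a_1,a_2]\in\mathcal{A}$ at $(a_1,a_2)$. (b) All greedy elements are indecomposable positive elements of $\mathcal{A}$. (c) The greedy elements $x[a_1,a_2]$ for $(a_1,a_2)\in\mathbb{Z}^2$ form a $\mathbb{Z}$-basis of $\mathcal{A}$ (called the greedy basis). (d) The greedy basis is independent of the choice of an initial cluster. (e) The greedy basis contains all cluster monomials.
   Context: Cluster algebra. Fix positive integers $b,c$. Let $\mathcal{F}=\mathbb{Q}(x_1,x_2)$ be the field of rational functions in two commuting independent variables. Define $x_m\in\mathcal{F}$ for all $m\in\mathbb{Z}$ recursively by $x_{m-1}x_{m+1}=x_m^b+1$ for $m$ odd and $x_{m-1}x_{m+1}=x_m^c+1$ for $m$ even. The cluster algebra $\mathcal{A}=\mathcal{A}(b,c)$ is the subring of $\mathcal{F}$ generated by all $x_m$ ($m\in\mathbb{Z}$). The $x_m$ are the cluster variables, the sets $\{x_m,x_{m+1}\}$ ($m\in\mathbb{Z}$) are the clusters, and a cluster monomial is an element $x_m^{d_1}x_{m+1}^{d_2}$ with $m\in\mathbb{Z}$ and $d_1,d_2\ge 0$ integers. By the Laurent phenomenon, for each $m$ every element of $\mathcal{A}$ is a Laurent polynomial with integer coefficients in $x_m,x_{m+1}$. Positivity. A non-zero $x\in\mathcal{A}$ is positive at the cluster $\{x_m,x_{m+1}\}$ if all the (nonzero)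 coefficients of its expansion as a Laurent polynomial in $x_m,x_{m+1}$ are positive; $x$ is positive if it is positive at all clusters. A positive element is indecomposable if it cannot be expressed as the sum of two positive elements. Pointed elements. An element $x\in\mathcal{A}$ is pointed at $(a_1,a_2)\in\mathbb{Z}^2$ if $$x=x_1^{-a_1}x_2^{-a_2}\sum_{p,q\ge 0}c(p,q)\,x_1^{bp}x_2^{cq}$$ with $c(p,q)\in\mathbb{Z}$ for all $p,q$ (finitely many nonzero) and $c(0,0)=1$. Greedy elements. Conventions: $\binom{a}{k}=0$ unless $0\le k\le a$; an empty sum is $0$. An element $x\in\mathcal{A}$ is greedy at $(a_1,a_2)\in\mathbb{Z}^2$ if it is pointed at $(a_1,a_2)$ and the coefficients $c(p,q)$ satisfy $$c(p,q)=\max\left(\sum_{k=1}^p(-1)^{k-1}c(p-k,q)\binom{a_2-cq+k-1}{k},\ \sum_{k=1}^q(-1)^{k-1}c(p,q-k)\binom{a_1-bp+k-1}{k}\right)$$ for every nonzero pair $(p,q)\in\mathbb{Z}_{\ge0}^2$. Such an element is denoted $x[a_1,a_2]$. Change of initial cluster (for (d)). The notion of greedy element above is relative to the initial cluster $\{x_1,x_2\}$. For another cluster $\{x_m,x_{m+1}\}$, greedy elements with respect to it are defined in the same way, with $x_1$ replaced by the odd-indexed cluster variable and $x_2$ by the even-indexed cluster variable of $\{x_m,x_{m+1}\}$. Part (d) says that the resulting set of greedy elements is the same for all $m\in\mathbb{Z}$. *)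

(* Defs.v *)
From HB Require Import structures.
From mathcomp Require Import all_boot all_order all_algebra finmap.
From mathcomp Require Import mpoly zify.

Set Implicit Arguments.
Unset Strict Implicit.
Unset Printing Implicit Defensive.

Import Order.TTheory GRing.Theory Num.Theory.
Local Open Scope ring_scope.

Definition ratfun : fieldType := {fraction {mpoly rat[2]}}.

Definition initial_x1 : ratfun := tofrac ('X_ord0 : {mpoly rat[2]}).
Definition initial_x2 : ratfun := tofrac ('X_ord_max : {mpoly rat[2]}).

Definition odd_int (m : int) : bool := odd `|m|%N.

Section ClusterAlgebra.

Variables b c : nat.

Definition exch_exp (m : int) : nat := if odd_int m then b else c.

(* The pair (x_(n+1), x_(n+2)). *)
Fixpoint clusters_up (n : nat) : ratfun * ratfun :=
  if n is k.+1 then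
    let: (u, v) := clusters_up k in
    (v, (v ^+ exch_exp (k%:Z + 2) + 1) / u)
  else (initial_x1, initial_x2).

(* The pair (x_(1-n), x_(2-n)). *)
Fixpoint clusters_down (n : nat) : ratfun * ratfun :=
  if n is k.+1 then
    let: (u, v) := clusters_down k in
    ((u ^+ exch_exp (1 - k%:Z) + 1) / v, u)
  else (initial_x1, initial_x2).

Definition cluster_var (m : int) : ratfun :=
  match m - 1 with
  | Posz n => (clusters_up n).1
  | Negz n => (clusters_down n.+1).1
  end.

(* Elements of the subring of Q(x_1, x_2) generated by the cluster variables. *)
Inductive cluster_algebra : ratfun -> Prop :=
  | ca_var m : cluster_algebra (cluster_var m)
  | ca_one : cluster_algebra 1
  | ca_sub f g : cluster_algebra f -> cluster_algebra g ->
      cluster_algebra (f - g)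
  | ca_mul f g : cluster_algebra f -> cluster_algebra g ->
      cluster_algebra (f * g).

(* A Laurent polynomial over Z in two variables is the finitely supported
   family of its coefficients, indexed by the pairs of exponents. *)
Definition laurent_eval (L : {fsfun int * int -> int with 0}) (u v : ratfun)
    : ratfun :=
  \sum_(d <- finsupp L) (L d)%:~R * u ^ d.1 * v ^ d.2.

(* The expansion L is unique, as x_m and x_(m+1) are algebraically independent;
   it exists for every f in the cluster algebra by the Laurent phenomenon. *)
Definition positive_at (m : int) (f : ratfun) : Prop :=
  exists L : {fsfun int * int -> int with 0},
    f = laurent_eval L (cluster_var m) (cluster_var (m + 1)) /\
    (forall d, d \in finsupp L -> 0 < L d).

Definition positive_elt (f : ratfun) : Prop :=
  [/\ cluster_algebra f, f != 0 & forall m, positive_at m f].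

Definition indecomposable_positive (f : ratfun) : Prop :=
  positive_elt f /\
  ~ (exists g h, [/\ positive_elt g, positive_elt h & f = g + h]).

(* The members of the cluster {x_m, x_(m+1)} with odd and with even index. *)
Definition odd_var (m : int) : ratfun :=
  cluster_var (if odd_int m then m else m + 1).
Definition even_var (m : int) : ratfun :=
  cluster_var (if odd_int m then m + 1 else m).

Definition pointed_with (m : int) (a : int * int)
    (C : {fsfun nat * nat -> int with 0}) (f : ratfun) : Prop :=
  [/\ cluster_algebra f,
      C (0%N, 0%N) = 1 &
      f = odd_var m ^ (- a.1) * even_var m ^ (- a.2) *
          \sum_(d <- finsupp C)
            (C d)%:~R * odd_var m ^+ (b * d.1) * even_var m ^+ (c * d.2)].

(* The binomial coefficient, with value 0 unless 0 <= k <= a; in particular it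
   vanishes for a < 0. *)
Definition binz (a : int) (k : nat) : int :=
  if a is Posz n then 'C(n, k)%:Z else 0.

Definition greedy_recurrence (a : int * int)
    (C : {fsfun nat * nat -> int with 0}) : Prop :=
  forall p q : nat, (p, q) != (0%N, 0%N) ->
    C (p, q) =
    Num.max
      (\sum_(1 <= k < p.+1) (-1) ^+ (k - 1)%N * C ((p - k)%N, q) *
         binz (a.2 - c%:Z * q%:Z + k%:Z - 1) k)
      (\sum_(1 <= k < q.+1) (-1) ^+ (k - 1)%N * C (p, (q - k)%N) *
         binz (a.1 - b%:Z * p%:Z + k%:Z - 1) k).

Definition greedy_at (m : int) (a : int * int) (f : ratfun) : Prop :=
  exists C : {fsfun nat * nat -> int with 0},
    pointed_with m a C f /\ greedy_recurrence a C.

Definition Zbasis_of_cluster_algebra (x : int * int -> ratfun) : Prop :=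
  (forall a, cluster_algebra (x a)) /\
  (forall f, cluster_algebra f ->
     exists! n : {fsfun int * int -> int with 0},
       f = \sum_(a <- finsupp n) x a *~ n a).

(* The divisions in the definition of [cluster_var] are genuine: no cluster
   variable is 0, so that the exchange relations hold. *)

Definition pos_quot (f : ratfun) : Prop :=
  exists p q : {mpoly rat[2]},
    [/\ 0 < p.@[fun=> 1], 0 < q.@[fun=> 1] & f = tofrac p / tofrac q].

Lemma meval_gt0_neq0 (p : {mpoly rat[2]}) :
  0 < p.@[fun=> 1] -> (tofrac p : ratfun) != 0.
Proof.
by move=> p_gt0; rewrite tofrac_eq0; apply: contraTneq p_gt0 => ->;
  rewrite meval0 ltxx.
Qed.

Lemma pos_quot_neq0 f : pos_quot f -> f != 0.
Proof.
by case=> p [q] [p0 q0 ->]; rewrite mulf_neq0 ?invr_eq0 // meval_gt0_neq0.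
Qed.

Lemma pos_quot_X (i : 'I_2) : pos_quot (tofrac ('X_i : {mpoly rat[2]})).
Proof.
exists 'X_i, 1; split; rewrite ?mevalXU ?meval1 //.
by rewrite tofrac1 divr1.
Qed.

Lemma pos_quot_exch n f g :
  pos_quot f -> pos_quot g -> pos_quot ((f ^+ n + 1) / g).
Proof.
case=> p [q] [p0 q0 ->] [r] [s] [r0 s0 ->].
exists ((p ^+ n + q ^+ n) * s), (q ^+ n * r); split.
- by rewrite mevalM mevalD !rmorphXn /= mulr_gt0 // addr_gt0 // exprn_gt0.
- by rewrite mevalM !rmorphXn /= mulr_gt0 // exprn_gt0.
have qn0 : (tofrac q : ratfun) ^+ n != 0.
  by rewrite expf_neq0 // meval_gt0_neq0.
rewrite !tofracM tofracD !tofracXn exprMn exprVn.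
rewrite -[X in _ / _ + X](divff qn0) -mulrDl invf_div mulf_div.
by [].
Qed.

Lemma pos_quot_up n :
  pos_quot (clusters_up n).1 /\ pos_quot (clusters_up n).2.
Proof.
elim: n => [|n] /=; first by split; exact: pos_quot_X.
by case: (clusters_up n) => u v [hu hv] /=; split=> //; exact: pos_quot_exch.
Qed.

Lemma pos_quot_down n :
  pos_quot (clusters_down n).1 /\ pos_quot (clusters_down n).2.
Proof.
elim: n => [|n] /=; first by split; exact: pos_quot_X.
by case: (clusters_down n) => u v [hu hv] /=; split=> //; exact: pos_quot_exch.
Qed.

Lemma cluster_var_neq0 m : cluster_var m != 0.
Proof.
apply: pos_quot_neq0; rewrite /cluster_var; case: (m - 1) => n.
  exact: (pos_quot_up n).1.
exact: (pos_quot_down n.+1).1.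
Qed.

Lemma cluster_var_up n : cluster_var (n%:Z + 1) = (clusters_up n).1.
Proof. by rewrite /cluster_var addrK. Qed.

Lemma cluster_var_down n : cluster_var (1 - n%:Z) = (clusters_down n).1.
Proof.
rewrite /cluster_var addrAC subrr add0r; case: n => [|n] //.
Qed.

Lemma cluster_var1 : cluster_var 1 = initial_x1. Proof. by []. Qed.
Lemma cluster_var2 : cluster_var 2 = initial_x2. Proof. by []. Qed.

Lemma exchange_relation m :
  cluster_var (m - 1) * cluster_var (m + 1) = cluster_var m ^+ exch_exp m + 1.
Proof.
have up2 n : (clusters_up n).2 = (clusters_up n.+1).1.
  by rewrite /=; case: (clusters_up n).
have down2 n : (clusters_down n.+1).2 = (clusters_down n).1.
  by rewrite /=; case: (clusters_down n).
have down02 n : cluster_var (2 - n%:Z) = (clusters_down n).2.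
  case: n => [|n]; first by [].
  by rewrite down2 -cluster_var_down; congr cluster_var; lia.
have [[n ->]|[n ->]] : (exists n : nat, m = n%:Z + 2) \/ (exists n : nat, m = 1 - n%:Z).
  case: (ltP 1 m) => hm.
    left; exists `|m - 2|%N; lia.
  right; exists `|1 - m|%N; lia.
- have -> : n%:Z + 2 - 1 = n%:Z + 1 by lia.
  have -> : n%:Z + 2 + 1 = n.+2%:Z + 1 by lia.
  have e2 : cluster_var (n%:Z + 2) = (clusters_up n.+1).1.
    by rewrite -cluster_var_up; congr cluster_var; lia.
  have nz := cluster_var_neq0 (n%:Z + 1).
  rewrite e2; move: nz; rewrite !cluster_var_up -[(clusters_up n.+2).1]up2 -up2 /=.
  by case: (clusters_up n) => u v /= nz; rewrite mulrC divfK.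
- have -> : 1 - n%:Z - 1 = 1 - n.+1%:Z by lia.
  have -> : 1 - n%:Z + 1 = 2 - n%:Z by lia.
  have nz := cluster_var_neq0 (2 - n%:Z).
  move: nz; rewrite down02 !cluster_var_down /=.
  by case: (clusters_down n) => u v /= nz; rewrite divfK.
Qed.

End ClusterAlgebra.

(* Main.v *)
Require Import Defs.
From HB Require Import structures.
From mathcomp Require Import all_boot all_order all_algebra.
From mathcomp Require Import finmap mpoly zify ring.

(** Why the theorem holds.

    Everything is read off one explicit polynomial.  Write a Laurent polynomial
    pointed at (a1, a2) as x1^-a1 x2^-a2 F(t, s) with t = x1^b and s = x2^c.
    Following Lee, Li and Zelevinsky, let F count the pairs (A, B) of compatible
    sets of horizontal and vertical edges of the maximal Dyck path in the
    rectangle [a1]_+ x [a2]_+, with weight t^|B| s^|A| ([dyck_poly]).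

    1. For a fixed A, forward walks starting at the edges of A decide which
       vertical edges can conflict with A at all (the shadow of A); the others are
       free.  When c|A| <= a2 exactly a2 - c|A| edges are free, so the coefficient
       of s^q in F is (1 + t)^[a2 - cq]_+ d_q with d_q having nonnegative
       coefficients, and the slope of the path bounds the degree of d_q strictly
       ([dyck_row_factor]).  Reversing the path exchanges the roles of the two
       variables, so the same holds for columns ([swapXY_dyck_poly]).

    2. Dividing by (1 + t)^n expresses the coefficients of d_q through the
       alternating sums of the greedy recurrence.  The degree bounds make the row
       sum equal to c(p, q) on one side of the line b p a2 = c q a1 and the column
       sum equal to it on the other side, and nonnegativity makes the remaining sum
       no larger.  Hence F satisfies the greedy recurrence ([factor_greedy]), and
       the factorizations with their bounds determine F ([factor_unique]).

    3. Exchanging x2 for x0 reverses the sequence of the d_q and replaces a2 by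
       a2' = c [a1]_+ - a2.  The reversed sequence satisfies the same bounds for
       (a1, a2') ([mut_row], [mut_col]); the one nontrivial point, that its columns
       are divisible by the right powers of 1 + s, follows from a multiplicative
       filtration ([weight_ge_homogenize]).  By uniqueness a greedy element is mapped
       to a greedy element ([greedy_elt_mutate]).  So the greedy elements of all
       clusters coincide, they contain the cluster monomials because those are
       pointed with F = 1 at their own cluster, and they are positive at every
       cluster.

    4. A Laurent polynomial whose rows and columns have these divisibilities can be
       reduced column by column modulo any family whose first column is
       (1 + s)^[a1]_+ ([span_divisible]).  With the products of x0, x1, x2, x3
       this shows that greedy elements lie in the cluster algebra; with the greedy
       elements themselves, and since the divisibilities are multiplicative, it shows
       that they span it.  They are independent because they are pointed at
       distinct exponents.

    5. If a greedy element is g + h with g and h positive, one of them, say g,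
       contains the monomial x1^-a1 x2^-a2.  Positivity of g at the two neighbouring
       clusters says that its coefficients are at least both sums of the greedy
       recurrence ([exchange_lower]); by induction they are at least those of
       the greedy element, whence h = 0. *)

Set Implicit Arguments.
Unset Strict Implicit.
Unset Printing Implicit Defensive.

Import Order.TTheory GRing.Theory Num.Theory.
Local Open Scope ring_scope.

(** * Maximal Dyck paths and compatible pairs of edge sets *)

Definition count_in (P : pred nat) (m n : nat) : nat := \sum_(m <= i < n) P i.

Lemma count_in_cat P m n p : (m <= n)%N -> (n <= p)%N ->
  count_in P m p = (count_in P m n + count_in P n p)%N.
Proof. by move=> mn np; rewrite /count_in (@big_cat_nat _ _ _ n). Qed.

Lemma count_in_geq P m n : (n <= m)%N -> count_in P m n = 0%N.
Proof. by move=> nm; rewrite /count_in big_geq. Qed.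

Lemma count_in_recr P m n : (m <= n)%N ->
  count_in P m n.+1 = (count_in P m n + P n)%N.
Proof. by move=> mn; rewrite /count_in big_nat_recr. Qed.

Lemma count_in_recl P m n : (m < n)%N ->
  count_in P m n = (P m + count_in P m.+1 n)%N.
Proof. by move=> mn; rewrite /count_in big_ltn. Qed.

Lemma eq_count_in P Q m n : (forall i, (m <= i < n)%N -> P i = Q i) ->
  count_in P m n = count_in Q m n.
Proof. by move=> eqPQ; rewrite /count_in; apply: eq_big_nat => i /eqPQ ->. Qed.

Lemma count_in_predC P m n : (m <= n)%N ->
  (count_in P m n + count_in (fun i => ~~ P i) m n = n - m)%N.
Proof.
move=> mn; rewrite /count_in -big_split /= -[RHS]muln1 -sum_nat_const_nat.
by apply: eq_bigr => i _; case: (P i).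
Qed.

Lemma count_in_periodic P L : (forall i, P (i + L)%N = P i) ->
  forall m n, count_in P (m + L) (n + L) = count_in P m n.
Proof.
move=> per m n; rewrite /count_in big_addn addnK.
by apply: eq_bigr => i _; rewrite per.
Qed.

Lemma count_in_period P L : (forall i, P (i + L)%N = P i) ->
  forall m, count_in P m (m + L) = count_in P 0 L.
Proof.
move=> per m; have [mL|Lm] := leqP m (m + L); last by lia.
have := count_in_periodic per 0 m; rewrite add0n => e.
have := count_in_cat P (leq0n m) mL.
have := count_in_cat P (leq0n L) (leq_addl m L).
lia.
Qed.

(** The excursion decomposition of a walk whose down-steps have size one.  A time is
    ground when the walk is at its minimum so far.  Between two consecutive ground
    times the walk either makes one step that does not go up, or it goes up, stays
    strictly above its starting level and comes back to exactly that level, because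
    it cannot jump over it on the way down. *)
Lemma ground_ind (phi : nat -> int) (G T : nat) (P : nat -> Prop)
    (ground := fun X => forall Y, (G <= Y <= X)%N -> phi X <= phi Y) :
  (forall X, phi X - 1 <= phi X.+1) ->
  P G ->
  (forall X, (G <= X < T)%N -> ground X -> P X -> phi X.+1 <= phi X ->
     P X.+1) ->
  (forall Y X, (G <= Y)%N -> (Y.+1 < X <= T)%N -> ground Y -> P Y ->
     phi X = phi Y -> phi X < phi X.-1 ->
     (forall Z, (Y < Z < X)%N -> phi Y < phi Z) -> P X) ->
  forall X, (G <= X <= T)%N -> ground X -> P X.
Proof.
move=> step PG Pstep Pexc X; elim/ltn_ind: X => X IH /andP[GX XT] grX.
case: (ltngtP G X) GX => // [GX _|<- //].
pose lowest Y := (G <= Y < X)%N && all (fun Z => phi Y <= phi Z) (index_iota G X).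
have [Y0 low0] : exists Y, lowest Y.
  pose i0 : 'I_X := Ordinal GX.
  case: (@arg_minP _ _ _ i0 (fun i => G <= i)%N (fun i : 'I_X => phi i)) => //= i Gi mini.
  exists i; rewrite /lowest Gi ltn_ord; apply/allP => Z; rewrite mem_index_iota => /andP[GZ ZX].
  exact: (mini (Ordinal ZX)).
have bound Y : lowest Y -> (Y <= X)%N by case/andP=> /andP[_ /ltnW].
case: (ex_maxnP (ex_intro _ Y0 low0) bound) => Y /andP[/andP[GY YX] /allP minY] maxY.
have minY' Z : (G <= Z < X)%N -> phi Y <= phi Z.
  by move=> h; apply: minY; rewrite mem_index_iota.
have aboveY Z : (Y < Z < X)%N -> phi Y < phi Z.
  move=> /andP[YZ ZX]; rewrite ltNge; apply/negP => ZY.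
  suff /maxY : lowest Z by lia.
  rewrite /lowest ZX (leq_trans GY (ltnW YZ)) /=; apply/allP => W.
  by rewrite mem_index_iota => /minY'; apply: le_trans.
have grY : ground Y by move=> Z hZ; apply: minY'; lia.
have PY : P Y by apply: IH => //; lia.
have XY : phi X <= phi Y by apply: grX; lia.
case: (ltngtP Y.+1 X) YX => // [YX _|eX _]; last first.
  by rewrite -eX; apply: Pstep => //; [lia | rewrite eX].
have up : phi Y < phi X.-1 by apply: aboveY; lia.
have := step X.-1; rewrite prednK; last by lia.
by move=> ?; apply: (Pexc Y) => //; lia.
Qed.

Section DyckPath.

Variables L a1 a2 : nat.
Hypothesis L_sum : L = (a1 + a2)%N.
Hypothesis L_gt0 : (0 < L)%N.

(** The maximal Dyck path in the a1 x a2 rectangle as a mechanical word of length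
    L = a1 + a2: after e edges the path is at the lattice point (x, y) with
    x + y = e and x a2 - y a1 = e a2 mod L, and the next edge is vertical as soon
    as it stays weakly below the diagonal.  Taking residues extends the path
    periodically, which replaces cyclic subpaths by intervals. *)
Definition horizontal (e : nat) : bool := (((e * a2) %% L) < a1)%N.

Definition mem_cyc (A : {set 'I_L}) (e : nat) : bool :=
  [exists i : 'I_L, (i \in A) && (i == (e %% L)%N :> nat)].

Lemma mem_cyc_ord (A : {set 'I_L}) (i : 'I_L) : mem_cyc A i = (i \in A).
Proof.
apply/existsP/idP => [[j /andP[jA /eqP ji]]|iA].
  by rewrite modn_small in ji => //; rewrite -(ord_inj ji).
by exists i; rewrite iA modn_small /=.
Qed.

Lemma mem_cycE (A : {set 'I_L}) e :
  mem_cyc A e = (Ordinal (ltn_pmod e L_gt0) \in A).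
Proof.
rewrite -mem_cyc_ord /mem_cyc /=.
by apply: eq_existsb => i; rewrite modn_mod.
Qed.

Lemma mem_cycD A e : mem_cyc A (e + L) = mem_cyc A e.
Proof. by rewrite /mem_cyc; apply: eq_existsb => i; rewrite modnDr. Qed.

Lemma mem_cyc_mod A e : mem_cyc A (e %% L) = mem_cyc A e.
Proof. by rewrite /mem_cyc; apply: eq_existsb => i; rewrite modn_mod. Qed.

Lemma count_mem_cyc A : count_in (mem_cyc A) 0 L = #|A|.
Proof.
rewrite /count_in big_mkord -sum1_card [RHS]big_mkcond /=.
by apply: eq_bigr => i _; rewrite mem_cyc_ord; case: (i \in A).
Qed.

Lemma horizontal_mod e : horizontal (e %% L) = horizontal e.
Proof. by rewrite /horizontal modnMml. Qed.

Lemma horizontalD e : horizontal (e + L) = horizontal e.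
Proof. by rewrite -horizontal_mod modnDr horizontal_mod. Qed.

Definition horizontals : {set 'I_L} := [set i : 'I_L | horizontal i].
Definition verticals : {set 'I_L} := [set i : 'I_L | ~~ horizontal i].

Lemma mem_cyc_horizontals e : mem_cyc horizontals e = horizontal e.
Proof. by rewrite mem_cycE inE /= horizontal_mod. Qed.

Lemma mem_cyc_verticals e : mem_cyc verticals e = ~~ horizontal e.
Proof. by rewrite mem_cycE inE /= horizontal_mod. Qed.

Lemma mem_cyc_sub (A B : {set 'I_L}) e : A \subset B -> mem_cyc A e -> mem_cyc B e.
Proof. by rewrite !mem_cycE => /subsetP; apply. Qed.

Definition countH := count_in horizontal.
Definition countV := count_in (fun e => ~~ horizontal e).

(** For the point (x, y) reached after e edges this is x a2 - y a1, its height
    below the diagonal; it always lies in [0, L). *)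
Definition offset (e : nat) : nat := ((e * a2) %% L)%N.

Lemma offset_lt e : (offset e < L)%N.
Proof. exact: ltn_pmod. Qed.

Lemma offset_step e :
  (offset e.+1)%:Z = (offset e)%:Z + (if horizontal e then a2%:Z else - a1%:Z).
Proof.
have: offset e.+1 = ((offset e + a2) %% L)%N by rewrite /offset modnDml mulSnr.
rewrite /horizontal -/(offset e); have lt := offset_lt e.
case: ltnP => h.
  by rewrite modn_small; lia.
have -> : (offset e + a2 = (offset e - a1) + L)%N by lia.
by rewrite modnDr modn_small; lia.
Qed.

Lemma offset_count X Y : (X <= Y)%N ->
  (offset Y)%:Z = (offset X)%:Z + (a2 * countH X Y)%:Z - (a1 * countV X Y)%:Z.
Proof.
move=> /subnKC <-; elim: (Y - X)%N => [|n IH].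
  by rewrite addn0 /countH /countV !count_in_geq //; lia.
rewrite addnS offset_step IH /countH /countV !count_in_recr ?leq_addr //.
by case: horizontal => /=; nia.
Qed.

Lemma card_horizontals : #|horizontals| = a1.
Proof.
have := offset_count (leq0n L); rewrite {1 2}/offset mul0n modnMr mod0n.
have := count_in_predC horizontal (leq0n L).
rewrite -count_mem_cyc.
have -> : count_in (mem_cyc horizontals) 0 L = countH 0 L.
  by apply: eq_count_in => i _; rewrite mem_cyc_horizontals.
rewrite -/(countH _ _) -/(countV _ _) L_sum; nia.
Qed.

Lemma card_verticals : #|verticals| = a2.
Proof.
have := cardsC horizontals.
have -> : ~: horizontals = verticals by apply/setP => i; rewrite !inE.
by rewrite card_horizontals card_ord; lia.
Qed.

(** A subpath that ends with a vertical edge is steep up to one horizontal edge: its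
    end has offset less than a2, while its start has nonnegative offset.  This is the
    only place where the slope of the path enters the degree bounds. *)
Lemma steep_subpath X Y : (X < Y)%N -> ~~ horizontal Y.-1 ->
  (a2 * countH X Y < a2 + a1 * countV X Y)%N.
Proof.
move=> XY; have := offset_count (ltnW XY).
have := offset_step Y.-1; rewrite prednK; last by lia.
by have := offset_lt Y.-1; case: horizontal => //=; lia.
Qed.

Section Compatibility.

Variables b c : nat.

(** Compatibility in the sense of Lee, Li and Zelevinsky asks, for an edge of A at E
    and an edge of B ending at X, for an interior point Z of the subpath where the
    number of vertical edges of E..Z equals c times the number of edges of A there,
    or symmetrically backwards from X.  Each count starts below its target and can
    only catch up by unit steps, so equality occurs somewhere if and only if the
    strict inequality fails somewhere; the strict form is the convenient one. *)
Definition fwd_blocked (A : {set 'I_L}) E X : bool :=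
  [forall Z : 'I_X, (E < Z)%N ==> (countV E Z < c * count_in (mem_cyc A) E Z)%N].

Definition bwd_blocked (B : {set 'I_L}) E X : bool :=
  [forall Z : 'I_X, (E < Z)%N ==> (countH Z X < b * count_in (mem_cyc B) Z X)%N].

Definition compatible (A B : {set 'I_L}) : bool :=
  [forall E : 'I_L, forall n : 'I_L, (E \in A) && mem_cyc B (E + n)%N ==>
    ~~ (fwd_blocked A E (E + n).+1 && bwd_blocked B E (E + n).+1)].

Lemma fwd_blockedP A E X :
  reflect (forall Z, (E < Z < X)%N -> (countV E Z < c * count_in (mem_cyc A) E Z)%N)
          (fwd_blocked A E X).
Proof.
apply: (iffP forallP) => [h Z /andP[EZ ZX]|h Z].
  by have := h (Ordinal ZX); rewrite EZ.
by apply/implyP => EZ; apply: h; rewrite EZ ltn_ord.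
Qed.

Lemma bwd_blockedP B E X :
  reflect (forall Z, (E < Z < X)%N -> (countH Z X < b * count_in (mem_cyc B) Z X)%N)
          (bwd_blocked B E X).
Proof.
apply: (iffP forallP) => [h Z /andP[EZ ZX]|h Z].
  by have := h (Ordinal ZX); rewrite EZ.
by apply/implyP => EZ; apply: h; rewrite EZ ltn_ord.
Qed.

Lemma bwd_blockedPn B E X : ~~ bwd_blocked B E X ->
  exists2 Z, (E < Z < X)%N & (b * count_in (mem_cyc B) Z X <= countH Z X)%N.
Proof.
rewrite negb_forall => /existsP[Z]; rewrite negb_imply -leqNgt => /andP[EZ h].
by exists Z => //; rewrite EZ ltn_ord.
Qed.

Lemma fwd_blockedD A E X : fwd_blocked A (E + L) (X + L) = fwd_blocked A E X.
Proof.
apply/fwd_blockedP/fwd_blockedP => h Z hZ.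
  have := h (Z + L)%N; rewrite !ltn_add2r => /(_ hZ).
  by rewrite /countV !count_in_periodic // => i; rewrite ?horizontalD ?mem_cycD.
have -> : Z = (Z - L + L)%N by lia.
rewrite /countV !count_in_periodic => [|i|i]; rewrite ?horizontalD ?mem_cycD //.
by apply: h; lia.
Qed.

Lemma bwd_blockedD B E X : bwd_blocked B (E + L) (X + L) = bwd_blocked B E X.
Proof.
apply/bwd_blockedP/bwd_blockedP => h Z hZ.
  have := h (Z + L)%N; rewrite !ltn_add2r => /(_ hZ).
  by rewrite /countH !count_in_periodic // => i; rewrite ?horizontalD ?mem_cycD.
have -> : Z = (Z - L + L)%N by lia.
rewrite /countH !count_in_periodic => [|i|i]; rewrite ?horizontalD ?mem_cycD //.
by apply: h; lia.
Qed.

Lemma fwd_blocked_mod A E n :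
  fwd_blocked A (E %% L) (E %% L + n) = fwd_blocked A E (E + n).
Proof.
rewrite {3 4}(divn_eq E L); elim: (E %/ L)%N => [|k IH]; first by rewrite mul0n add0n.
have e x : (k.+1 * L + x = k * L + x + L)%N by lia.
by rewrite -addnA !e fwd_blockedD addnA IH.
Qed.

Lemma bwd_blocked_mod B E n :
  bwd_blocked B (E %% L) (E %% L + n) = bwd_blocked B E (E + n).
Proof.
rewrite {3 4}(divn_eq E L); elim: (E %/ L)%N => [|k IH]; first by rewrite mul0n add0n.
have e x : (k.+1 * L + x = k * L + x + L)%N by lia.
by rewrite -addnA !e bwd_blockedD addnA IH.
Qed.

Lemma compatibleP A B :
  reflect (forall E X, (E < X <= E + L)%N -> mem_cyc A E -> mem_cyc B X.-1 ->
             fwd_blocked A E X -> ~~ bwd_blocked B E X)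
          (compatible A B).
Proof.
apply: (iffP idP) => [h E X hX AE BX fE|h].
  have hn : (X.-1 - E < L)%N by lia.
  have /forallP/(_ (Ordinal hn))/implyP := forallP h (Ordinal (ltn_pmod E L_gt0)).
  rewrite -mem_cycE AE /= -mem_cyc_mod modnDml mem_cyc_mod.
  have e : (E + (X.-1 - E) = X.-1)%N by lia.
  rewrite e => /(_ BX); rewrite -addnS fwd_blocked_mod bwd_blocked_mod addnS e.
  by rewrite prednK ?fE //; lia.
apply/forallP => E; apply/forallP => n; apply/implyP => /andP[EA Bn].
rewrite negb_and -implybE; apply/implyP => fE.
by apply: h; rewrite ?mem_cyc_ord //; have := ltn_ord n; lia.
Qed.

(** Walk through the region blocked by E.  At an edge of B compatibility produces an
    interior point Z with at least b |B| horizontal edges after it, counting B only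
    after Z; induction treats the part before Z.  The horizontal edge at E itself is
    never used, since Z is interior: this is the source of all strict bounds. *)
Lemma compatible_dominated (A B : {set 'I_L}) E X : A \subset horizontals ->
  compatible A B -> B \subset verticals -> (X <= E + L)%N ->
  mem_cyc A E -> fwd_blocked A E X ->
  forall Z, (E < Z <= X)%N ->
    (b * count_in (mem_cyc B) E Z <= countH E.+1 Z)%N.
Proof.
move=> sA /compatibleP comp sB XL AE /fwd_blockedP fE.
elim/ltn_ind => Z IH /andP[EZ ZX].
have hE : horizontal E by rewrite -mem_cyc_horizontals (mem_cyc_sub sA).
have BE : mem_cyc B E = false.
  by apply: contraTF hE => BE; rewrite -mem_cyc_verticals (mem_cyc_sub sB).
case: (ltngtP E.+1 Z) EZ => // [EZ _|<- _]; last first.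
  by rewrite count_in_recr // BE /countH !count_in_geq //; lia.
case: Z => // Z in EZ ZX IH *.
rewrite count_in_recr; last by lia.
rewrite {1}/countH count_in_recr; last by lia.
case BZ : (mem_cyc B Z); last first.
  rewrite addn0; have := IH Z; rewrite /countH; case: (horizontal Z); lia.
have /bwd_blockedPn[W hW] : ~~ bwd_blocked B E Z.+1.
  apply: comp => //; first by lia.
  by apply/fwd_blockedP => W hW; apply: fE; lia.
have := IH W; rewrite /countH.
have lt : (W <= Z)%N by lia.
rewrite !(count_in_recr _ lt) BZ.
have e1 := @count_in_cat (mem_cyc B) E W Z; have e2 := @count_in_cat horizontal E.+1 W Z.
rewrite e1 ?e2; try lia.
Qed.

Lemma mem_cycI (A B : {set 'I_L}) e :
  mem_cyc (A :&: B) e = mem_cyc A e && mem_cyc B e.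
Proof. by rewrite !mem_cycE inE. Qed.

(** The vertical edges that some edge of A blocks in the forward direction.  Only
    these can ever be incompatible with A. *)
Definition shadow (A : {set 'I_L}) : {set 'I_L} :=
  [set v in verticals | [exists E : 'I_L, exists n : 'I_L,
     [&& E \in A, ((E + n) %% L)%N == v & fwd_blocked A E (E + n).+1]]].

Lemma shadow_sub A : shadow A \subset verticals.
Proof. by apply/subsetP => v; rewrite inE => /andP[]. Qed.

Lemma mem_shadow A E X : mem_cyc A E -> (E <= X < E + L)%N ->
  ~~ horizontal X -> fwd_blocked A E X.+1 -> mem_cyc (shadow A) X.
Proof.
move=> AE hX vX fE; rewrite mem_cycE inE inE /= horizontal_mod vX /=.
have hn : (X - E < L)%N by lia.
apply/existsP; exists (Ordinal (ltn_pmod E L_gt0)).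
apply/existsP; exists (Ordinal hn) => /=.
rewrite -mem_cycE AE modnDml subnKC /= ?eqxx /=; last by lia.
by rewrite -addnS fwd_blocked_mod addnS subnKC //; lia.
Qed.

Lemma shadowP A X : mem_cyc (shadow A) X -> (L <= X)%N ->
  exists E, [/\ (E <= X < E + L)%N, mem_cyc A E & fwd_blocked A E X.+1].
Proof.
rewrite mem_cycE inE /= => /andP[_ /existsP[E /existsP[n /and3P[AE /eqP e fE]]]] LX.
have ltn := ltn_ord n.
have eE : ((X - n) %% L = E)%N.
  rewrite -[RHS](modn_small (ltn_ord E)); apply/eqP; rewrite -(eqn_modDr n) e subnK //; lia.
exists (X - n)%N; split; first by lia.
  by rewrite -mem_cyc_mod eE mem_cyc_ord.
have -> : X.+1 = ((X - n) + n.+1)%N by lia.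
by rewrite -fwd_blocked_mod eE addnS.
Qed.

(** If E blocks X in the forward direction, then every vertical edge between them is
    in the shadow, so deleting the edges of B outside the shadow changes none of the
    counts that enter a conflict. *)
Lemma compatible_shadow (A B : {set 'I_L}) : B \subset verticals ->
  compatible A B = compatible A (B :&: shadow A).
Proof.
move=> sB.
have same E X : mem_cyc A E -> (E < X <= E + L)%N -> fwd_blocked A E X ->
    forall Z, (E <= Z < X)%N -> mem_cyc (B :&: shadow A) Z = mem_cyc B Z.
  move=> AE hX /fwd_blockedP fE Z hZ; rewrite mem_cycI.
  case BZ : (mem_cyc B Z) => //=; apply: (mem_shadow AE); first by lia.
    by rewrite -mem_cyc_verticals (mem_cyc_sub sB).
  by apply/fwd_blockedP => W hW; apply: fE; lia.
have bwd E X : mem_cyc A E -> (E < X <= E + L)%N -> fwd_blocked A E X ->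
    bwd_blocked (B :&: shadow A) E X = bwd_blocked B E X.
  move=> AE hX fE; rewrite /bwd_blocked; apply: eq_forallb => Z.
  case: ltnP => //= EZ; congr (_ < _ * _)%N.
  by apply: eq_count_in => i hi; apply: (same E X) => //; lia.
apply/compatibleP/compatibleP => h E X hX AE BX fE.
- by rewrite bwd //; apply: h => //; rewrite -(same E X) //; lia.
- by rewrite -bwd //; apply: h => //; rewrite (same E X) //; lia.
Qed.

Definition height (A : {set 'I_L}) X : int :=
  (c * count_in (mem_cyc A) 0 X)%:Z - (countV 0 X)%:Z.

Lemma height_diff A E Z : (E <= Z)%N ->
  height A Z = height A E + (c * count_in (mem_cyc A) E Z)%:Z - (countV E Z)%:Z.
Proof.
move=> EZ; rewrite /height /countV !(count_in_cat _ (leq0n E) EZ); nia.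
Qed.

Lemma height_period A X : height A (X + L) = height A X + (c * #|A|)%:Z - a2%:Z.
Proof.
rewrite (height_diff A (leq_addr L X)) /countV.
rewrite (@count_in_period _ L (mem_cycD A)) count_mem_cyc.
rewrite (@count_in_period _ L); last by move=> i; rewrite horizontalD.
congr (_ - _%:Z); rewrite -[RHS]card_verticals -count_mem_cyc.
by apply: eq_count_in => i _; rewrite mem_cyc_verticals.
Qed.

Lemma fwd_blocked_height A E X :
  reflect (forall Z, (E < Z < X)%N -> height A E < height A Z) (fwd_blocked A E X).
Proof.
apply: (iffP (fwd_blockedP A E X)) => h Z hZ; have := h Z hZ.
  by rewrite (@height_diff A E Z); lia.
by rewrite (@height_diff A E Z); lia.
Qed.

Section FixA.
Variable A : {set 'I_L}.
Hypothesis subA : A \subset horizontals.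
Hypothesis c_gt0 : (0 < c)%N.

Lemma height_step X : height A X.+1 =
  height A X + (if mem_cyc A X then c%:Z else 0) - (~~ horizontal X : nat)%:Z.
Proof.
rewrite (height_diff A (leqnSn X)) /countV !count_in_recr // !count_in_geq // !add0n.
by case: mem_cyc; rewrite ?muln1 ?muln0.
Qed.

Lemma mem_cyc_horizontal X : mem_cyc A X -> horizontal X.
Proof. by rewrite -mem_cyc_horizontals; apply: mem_cyc_sub. Qed.

Lemma rising_edge X : height A X < height A X.+1 -> mem_cyc A X.
Proof. by rewrite height_step; case: mem_cyc => //; lia. Qed.

(** When the walk does not gain height over a period, every earlier point is at least
    as high as its translate, so a minimum over one period is a minimum over the
    whole past. *)
Lemma deficit_ground : (c * #|A| <= a2)%N ->
  exists2 G, (L <= G < L + L)%N & forall X, (X <= G + L)%N ->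
    (X < L + L)%N -> height A G <= height A X.
Proof.
move=> def.
case: (@arg_minP _ _ _ (Ordinal L_gt0) xpredT (fun i : 'I_L => height A (i + L))) => //= i _ mini.
exists (i + L)%N; first by have := ltn_ord i; lia.
move=> X _ X2; case: (ltnP X L) => XL.
  have /= h := mini (Ordinal XL) isT; have p := height_period A X.
  move: h p def; move: (height A (X + L)) (c * #|A|)%N => *. lia.
have hX : (X - L < L)%N by lia.
by have := mini (Ordinal hX) isT; rewrite /= subnK.
Qed.

(** Start at a point that is lowest in the whole past and cut one period into
    excursions.  The vertical edges outside the shadow are exactly the steps at which
    the walk reaches a new minimum, and there are as many of them as the total drop
    a2 - c|A|.  An excursion contains c|A| vertical edges and is dominated by its
    first edge, so domination and steepness bound the edges of B in it, with a strict
    inequality; summing over the excursions gives the second claim. *)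
Lemma deficit_shadow (B : {set 'I_L}) : (c * #|A| <= a2)%N ->
  B \subset shadow A -> compatible A B ->
  #|verticals :\: shadow A| = (a2 - c * #|A|)%N /\
  ((0 < #|A|)%N -> (b * #|B| * a2 < c * #|A| * a1)%N).
Proof.
move=> def sB comp; have [G hG minG] := deficit_ground def.
have sBV : B \subset verticals := subset_trans sB (shadow_sub A).
set N := verticals :\: shadow A.
have memN X : mem_cyc N X = ~~ mem_cyc (shadow A) X && ~~ horizontal X.
  by rewrite -mem_cyc_verticals !mem_cycE inE.
(* The boolean records the strict gain made by the first excursion. *)
pose P X := height A G - height A X = (count_in (mem_cyc N) G X)%:Z /\
  (a2 * b * count_in (mem_cyc B) G X + (0 < count_in (mem_cyc A) G X)
     <= a1 * c * count_in (mem_cyc A) G X)%N.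
have [] : P (G + L)%N; last first.
  rewrite !(@count_in_period _ L (mem_cycD _)) !count_mem_cyc height_period => e1 e2.
  split; first by lia.
  by move=> A0; move: e2; rewrite A0; nia.
apply: (@ground_ind (height A) G (G + L)) => //.
- by move=> X; rewrite height_step; case: mem_cyc; case: horizontal => /=; lia.
- by split; rewrite !count_in_geq //; lia.
- move=> X hX grX [e1 e2] down.
  have AX : mem_cyc A X = false.
    case AX : (mem_cyc A X) => //; move: down.
    by rewrite height_step AX (mem_cyc_horizontal AX) /=; lia.
  have GX : (G <= X)%N by lia.
  have shX : mem_cyc (shadow A) X = false.
    case sX : (mem_cyc (shadow A) X) => //; have LX : (L <= X)%N by lia.
    have [E [hE AE /fwd_blocked_height fE]] := shadowP sX LX.
    case: (ltnP E G) => EG.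
      have := fE G; have := minG E; lia.
    case: (ltngtP E X) hE => // [EX|EX] hE; last by rewrite EX AX in AE.
    have := fE X; have := grX E; lia.
  have BX : mem_cyc B X = false.
    by apply: contraFF shX => BX; rewrite (mem_cyc_sub sB).
  split; rewrite !count_in_recr // ?AX ?BX ?addn0 //.
  by rewrite memN shX /= height_step AX; lia.
- move=> Y X GY hX grY [e1 e2] eq_h down above.
  have AY : mem_cyc A Y by apply: rising_edge; apply: above; lia.
  have blk : fwd_blocked A Y X by apply/fwd_blocked_height.
  have XL : (X <= Y + L)%N by lia.
  have YX : (Y <= X)%N by lia.
  have lt1 : (Y < X <= X)%N by lia.
  have dom := compatible_dominated subA comp sBV XL AY blk lt1.
  have vX : ~~ horizontal X.-1.
    move: down; have := height_step X.-1; rewrite prednK; last by lia.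
    by case: mem_cyc; case: horizontal => //=; lia.
  have steep := @steep_subpath Y X _ vX.
  have cH : countH Y X = (countH Y.+1 X).+1.
    by rewrite /countH count_in_recl ?(mem_cyc_horizontal AY) //; lia.
  have := height_diff A YX => eh.
  have cA : (0 < count_in (mem_cyc A) Y X)%N.
    by rewrite count_in_recl ?AY //; lia.
  have cN : count_in (mem_cyc N) Y X = 0%N.
    rewrite /count_in big_nat big1 // => i hi; rewrite memN.
    case hi' : (horizontal i); rewrite ?andbF //= andbT.
    rewrite (mem_shadow AY) //=; [by lia | by rewrite hi' |].
    by apply/fwd_blocked_height => W hW; apply: above; lia.
  split; rewrite !(count_in_cat _ GY YX); first by rewrite cN; lia.
  have -> : (0 < count_in (mem_cyc A) G Y + count_in (mem_cyc A) Y X)%N by lia.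
  have : (c * count_in (mem_cyc A) Y X = countV Y X)%N by lia.
  move: steep; rewrite cH; nia.
- by rewrite leq_addr leqnn.
- move=> Y hY; rewrite height_period.
  case: (ltnP Y (L + L)) => YL; first by have := minG Y; lia.
  by have := height_period A (Y - L); rewrite subnK; [have := minG (Y - L)%N; lia | lia].
Qed.

(** When the walk gains height over a period, the edge after its last minimum blocks
    the whole period, and domination applies to the full path at once. *)
Lemma surplus_bound (B : {set 'I_L}) : (a2 < c * #|A|)%N ->
  B \subset verticals -> compatible A B -> (b * #|B| < a1)%N.
Proof.
move=> sur sB comp.
pose low X := (X < L)%N && [forall Z : 'I_L, height A X <= height A Z].
have exlow : exists X, low X.
  case: (@arg_minP _ _ _ (Ordinal L_gt0) xpredT (fun i : 'I_L => height A i)) => //= i _ mini.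
  by exists i; rewrite /low ltn_ord; apply/forallP => Z; apply: mini.
have bd X : low X -> (X <= L)%N by case/andP => /ltnW.
case: (ex_maxnP exlow bd) => G /andP[GL /forallP minG] maxG.
have above Z : (G < Z < (G + L).+1)%N -> height A G < height A Z.
  move=> hZ; case: (ltnP Z L) => ZL.
    rewrite ltNge; apply/negP => ZG; suff /maxG : low Z by lia.
    rewrite /low ZL; apply/forallP => W; exact: le_trans ZG (minG W).
  have hZL : (Z - L < L)%N by lia.
  have /= h := minG (Ordinal hZL); have := height_period A (Z - L).
  rewrite subnK // => p; move: h p sur; move: (c * #|A|)%N => *; lia.
have AG : mem_cyc A G by apply: rising_edge; apply: above; lia.
have blk : fwd_blocked A G (G + L).
  by apply/fwd_blocked_height => Z hZ; apply: above; lia.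
have lt1 : (G < G + L <= G + L)%N by lia.
have := compatible_dominated subA comp sB (leqnn _) AG blk lt1.
rewrite (@count_in_period _ L (mem_cycD _)) count_mem_cyc.
have : countH G (G + L) = a1.
  rewrite /countH (@count_in_period _ L horizontalD) -card_horizontals -count_mem_cyc.
  by apply: eq_count_in => i _; rewrite mem_cyc_horizontals.
rewrite {1}/countH count_in_recl ?(mem_cyc_horizontal AG); last by lia.
by rewrite -/(countH _ _); lia.
Qed.

End FixA.
End Compatibility.
End DyckPath.

(** * The generating polynomial of compatible pairs *)

Lemma sum_subset_Xn (T : finType) (N : {set T}) :
  \sum_(J in powerset N) 'X^#|J| = (1 + 'X) ^+ #|N| :> {poly int}.
Proof.
transitivity (\prod_i ((if i \in N then 'X else 0) + 1 : {poly int})); last first.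
  rewrite (bigID (mem N)) /= (eq_bigr (fun=> 1 + 'X)); last first.
    by move=> i ->; rewrite addrC.
  rewrite prodr_const [X in _ * X]big1 ?mulr1 // => i /negbTE ->.
  by rewrite add0r.
rewrite bigA_distr [LHS]big_mkcond /=; apply: eq_bigr => J _.
rewrite powersetE; case: ifPn => [JN|/subsetPn[i iJ iN]].
  rewrite -prodr_const big_mkcond /=; apply: eq_bigr => i _.
  by case: ifPn => // /(subsetP JN) ->.
by rewrite (bigD1 i) //= iJ (negbTE iN) mul0r.
Qed.

(** If membership in P only depends on the part of B inside D, the elements of V
    outside D are free and contribute a power of 1 + X. *)
Lemma sum_subset_split (T : finType) (V D : {set T}) (P : pred {set T}) :
  D \subset V -> {in powerset V, forall B, P B = P (B :&: D)} ->
  \sum_(B in powerset V | P B) 'X^#|B| =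
  (1 + 'X) ^+ #|V :\: D| * \sum_(B in powerset D | P B) 'X^#|B| :> {poly int}.
Proof.
move=> DV invP; rewrite mulr_sumr.
rewrite (partition_big (fun B => B :&: D) (fun B => (B \in powerset D) && P B)) /=; last first.
  by move=> B /andP[BV PB]; rewrite powersetE subsetIr -invP.
apply: eq_bigr => B0 /andP[]; rewrite powersetE => B0D PB0.
rewrite -sum_subset_Xn mulr_suml.
rewrite (reindex_onto (fun J => B0 :|: J) (fun B => B :\: D)) /=; last first.
  by move=> B /andP[_ /eqP <-]; rewrite setID.
apply: eq_big => [J|J].
  rewrite powersetE -[(J \in _)]/(J \in powerset (V :\: D)) powersetE.
  apply/idP/idP.
    case/andP=> /andP[/andP[sV _] _] /eqP <-.
    by rewrite setSD.
  rewrite subsetD => /andP[JV dJ].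
  have e1 : (B0 :|: J) :&: D = B0.
    by rewrite setIUl (setIidPl B0D) [J :&: D]disjoint_setI0 ?setU0.
  have e2 : (B0 :|: J) :\: D = J.
    rewrite setDUl (_ : B0 :\: D = set0) ?set0U; first by apply/setDidPl.
    by apply/eqP; rewrite setD_eq0.
  have sV : B0 :|: J \subset V by rewrite subUset JV (subset_trans B0D).
  by rewrite sV e1 e2 !eqxx invP ?powersetE // e1 PB0.
case/andP=> /andP[_ /eqP eI] /eqP eD.
by rewrite -(cardsID D (B0 :|: J)) eI eD exprD mulrC.
Qed.

(** The factorization shared by all rows of a greedy polynomial.  The rows of F are
    its coefficients in the outer variable s, as polynomials in t.  For q > 0 the
    exponents p in d_q lie strictly to the left of the line b p a2 = c q a1 if
    c q <= a2, and of the line b p = a1 beyond; these strict bounds are what makes F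
    unique. *)
Definition row_factor (b c a1 a2 : nat) (F : {poly {poly int}})
    (d : nat -> {poly int}) : Prop :=
  [/\ d 0%N = 1,
      forall q, F`_q = (1 + 'X) ^+ (a2 - c * q)%N * d q &
      forall q r, (0 < q)%N -> (d q)`_r != 0 ->
        ((c * q <= a2)%N -> (b * r * a2 < c * q * a1)%N) /\
        ((a2 < c * q)%N -> (b * r < a1)%N)].

Section DyckPoly.

Variables (L a1 a2 b c : nat).

Definition dyck_poly : {poly {poly int}} :=
  \sum_(A in powerset (horizontals L a1 a2))
    \sum_(B in powerset (verticals L a1 a2) | compatible a1 a2 b c A B)
      ('X^#|B|)%:P * 'X^#|A|.

Definition row_quotient_at (A : {set 'I_L}) : {poly int} :=
  \sum_(B in powerset (if (c * #|A| <= a2)%N then shadow a1 a2 c A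
                       else verticals L a1 a2) | compatible a1 a2 b c A B) 'X^#|B|.

Definition row_quotient (q : nat) : {poly int} :=
  \sum_(A in powerset (horizontals L a1 a2) | #|A| == q) row_quotient_at A.

Lemma row_quotient_ge0 q r : 0 <= (row_quotient q)`_r.
Proof.
rewrite coef_sum; apply: sumr_ge0 => A _; rewrite coef_sum; apply: sumr_ge0 => B _.
by rewrite coefXn ler0n.
Qed.

Lemma coef_dyck_poly q : dyck_poly`_q =
  \sum_(A in powerset (horizontals L a1 a2) | #|A| == q)
    \sum_(B in powerset (verticals L a1 a2) | compatible a1 a2 b c A B) 'X^#|B|.
Proof.
rewrite coef_sum [RHS]big_mkcondr /=; apply: eq_bigr => A _.
rewrite coef_sum; case: eqP => [e|/eqP ne].
  by apply: eq_bigr => B _; rewrite coefCM coefXn e eqxx mulr1.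
by rewrite big1 // => B _; rewrite coefCM coefXn eq_sym (negbTE ne) mulr0.
Qed.

Hypothesis L_sum : L = (a1 + a2)%N.
Hypothesis c_gt0 : (0 < c)%N.

Lemma compatible0r A : compatible a1 a2 b c A (set0 : {set 'I_L}).
Proof.
apply/forallP => E; apply/forallP => n; rewrite /mem_cyc.
case: existsP => [[i]|_]; last by rewrite andbF.
by rewrite inE.
Qed.

Lemma shadow0 : shadow a1 a2 c (set0 : {set 'I_L}) = set0.
Proof.
apply/setP => v; rewrite !inE; apply/negP => /andP[_ /existsP[E /existsP[n]]].
by rewrite inE.
Qed.

(** The free vertical edges give the power of 1 + t.  What remains counts pairs with
    B inside the shadow of A when c|A| <= a2, and all pairs otherwise; their sizes
    are bounded by [deficit_shadow] and [surplus_bound]. *)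
Lemma dyck_row_factor : row_factor b c a1 a2 dyck_poly row_quotient.
Proof.
have cardA A : A \in powerset (horizontals L a1 a2) -> (0 < #|A|)%N -> (0 < L)%N.
  by move=> _ A0; rewrite -[L]card_ord (leq_trans A0) // max_card.
split.
- rewrite /row_quotient (big_pred1 set0) => [|A]; last first.
    by rewrite cards_eq0 powersetE /=; case: eqP => [->|]; rewrite ?sub0set ?andbF.
  rewrite /row_quotient_at cards0 muln0 leq0n shadow0 powerset0.
  rewrite (big_pred1 set0) ?cards0 ?expr0 // => B.
  by rewrite inE /=; case: eqP => [->|//]; rewrite compatible0r.
- move=> q; rewrite coef_dyck_poly mulr_sumr; apply: eq_bigr => A /andP[AH /eqP Aq].
  rewrite /row_quotient_at Aq; case: leqP => [le|/ltnW lt]; last first.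
    by rewrite (eqP lt) expr0 mul1r.
  have [L0|L0] := posnP L.
    have -> : verticals L a1 a2 = shadow a1 a2 c A.
      by apply/setP => i; have := ltn_ord i; rewrite {2}L0.
    have -> : (a2 - c * q = 0)%N by lia.
    by rewrite expr0 mul1r.
  rewrite powersetE in AH.
  rewrite (@sum_subset_split _ _ (shadow a1 a2 c A)); first 1 last.
  - exact: shadow_sub.
  - by move=> B; rewrite powersetE => BV; apply: compatible_shadow.
  have le' : (c * #|A| <= a2)%N by rewrite Aq.
  have [-> _] := deficit_shadow L_sum L0 AH c_gt0 le' (sub0set _) (compatible0r A).
  by rewrite Aq.
- move=> q r q0; rewrite /row_quotient coef_sum.
  have [/exists_inP[A /andP[AH /eqP Aq] nz] _|/exists_inPn h] :=
    boolP [exists (A | (A \in powerset (horizontals L a1 a2)) && (#|A| == q)),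
     (row_quotient_at A)`_r != 0]; last first.
    by rewrite big1 ?eqxx // => A hA; apply/eqP; have := h A hA; rewrite negbK.
  move: nz; rewrite /row_quotient_at coef_sum.
  set Q := if _ then _ else _.
  have [/exists_inP[B /andP[BQ cAB] nz] _|/exists_inPn h] :=
    boolP [exists (B | (B \in powerset Q) && compatible a1 a2 b c A B),
     ('X^#|B| : {poly int})`_r != 0]; last first.
    by rewrite big1 ?eqxx // => B hB; apply/eqP; have := h B hB; rewrite negbK.
  have -> : r = #|B| by move: nz; rewrite coefXn; case: (r =P #|B|); rewrite ?eqxx.
  have L0 : (0 < L)%N by apply: (cardA A) => //; rewrite Aq.
  move: BQ; rewrite /Q !powersetE => BQ; rewrite powersetE in AH.
  rewrite -Aq; split=> h; move: BQ.
    rewrite h => BQ; have [_ ] := deficit_shadow L_sum L0 AH c_gt0 h BQ cAB; apply; lia.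
  by rewrite leqNgt h /= => BQ; apply: (surplus_bound L_sum L0 AH c_gt0).
Qed.

End DyckPoly.

Section Reversal.

Lemma count_in_rev P (M m n : nat) : (m <= n <= M)%N ->
  count_in (fun e => P (M.-1 - e)%N) m n = count_in P (M - n) (M - m).
Proof.
case/andP=> /subnKC <-; elim: (n - m)%N => [|k IH] hM.
  by rewrite !addn0 !count_in_geq.
rewrite addnS count_in_recr ?leq_addr // IH; last by lia.
rewrite [RHS]count_in_recl; last by lia.
have -> : ((M - (m + k).+1).+1 = M - (m + k))%N by lia.
have -> : (M.-1 - (m + k) = M - (m + k).+1)%N by lia.
by rewrite addnC.
Qed.

Variables (L a1 a2 : nat).
Hypothesis L_sum : L = (a1 + a2)%N.

(** Reading the path backwards exchanges horizontal and vertical edges and gives the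
    path of the transposed rectangle, because a1 = - a2 modulo a1 + a2. *)
Lemma horizontal_rev e f : (0 < L)%N -> (L %| (e + f).+1)%N ->
  horizontal L a2 a1 f = ~~ horizontal L a1 a2 e.
Proof.
move=> L0 /dvdnP[k hk]; rewrite /horizontal.
have -> : ((f * a1) %% L = ((e * a2) %% L + a2) %% L)%N.
  rewrite modnDml -(modnMDl e.+1) -[RHS](modnMDl (k * a1)); congr (_ %% _)%N.
  have -> : (k * a1 * L = (e + f).+1 * a1)%N by rewrite hk; lia.
  by rewrite L_sum; lia.
have := ltn_pmod (e * a2) L0; move: ((e * a2) %% L)%N => t lt.
case: (ltnP t a1) => ht; first by rewrite modn_small; lia.
have -> : (t + a2 = (t - a1) + L)%N by lia.
by rewrite modnDr modn_small; lia.
Qed.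

Definition rev_set (A : {set 'I_L}) : {set 'I_L} := [set rev_ord i | i in A].

Lemma rev_setK : involutive rev_set.
Proof.
move=> A; rewrite /rev_set -imset_comp (eq_imset (g := id)) ?imset_id //.
by move=> i /=; rewrite rev_ordK.
Qed.

Lemma mem_rev_set A i : (i \in rev_set A) = (rev_ord i \in A).
Proof. by rewrite -[i in LHS]rev_ordK mem_imset //; apply: rev_ord_inj. Qed.

Lemma card_rev_set A : #|rev_set A| = #|A|.
Proof. by rewrite card_imset //; apply: rev_ord_inj. Qed.

Lemma mem_cyc_rev e f A : (0 < L)%N -> (L %| (e + f).+1)%N ->
  mem_cyc (rev_set A) f = mem_cyc A e.
Proof.
move=> L0 dv; rewrite !(mem_cycE L0) mem_rev_set; congr (_ \in A).
apply: ord_inj => /=.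
have {dv} : (L %| (e %% L + f %% L).+1)%N.
  by move: dv; rewrite /dvdn -addn1 -modnDml -(modnDm e f) modnDml addn1.
have := ltn_pmod e L0; have := ltn_pmod f L0.
move: (e %% L)%N (f %% L)%N => x y hy hx /dvdnP[[|[|k]]]; lia.
Qed.

(** Compatibility is symmetric under reversal of the path: forward and backward
    blocking are exchanged, together with b and c. *)
Lemma compatible_rev1 b c A B : compatible a1 a2 b c A B ->
  compatible a2 a1 c b (rev_set B) (rev_set A).
Proof.
have [L0|L0] := posnP L.
  by move=> _; apply/forallP => E; have := ltn_ord E; rewrite {2}L0.
have L_sum' : L = (a2 + a1)%N by rewrite addnC.
move/(compatibleP L_sum L0) => comp; apply/(compatibleP L_sum' L0) => E X hX BE AX fwd.
apply/negP => bwd.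
(* A multiple of the period large enough to reflect the interval E..X. *)
pose M := (X * L)%N.
have dM e : (e < M)%N -> (L %| (M.-1 - e + e).+1)%N.
  by move=> he; rewrite subnK ?prednK ?dvdn_mull //; lia.
have XM : (X <= M)%N by rewrite leq_pmulr.
have eA e : (e < M)%N -> mem_cyc (rev_set A) e = mem_cyc A (M.-1 - e)%N.
  by move=> /dM; apply: mem_cyc_rev.
have eB e : (e < M)%N -> mem_cyc (rev_set B) e = mem_cyc B (M.-1 - e)%N.
  by move=> /dM; apply: mem_cyc_rev.
have eh e : (e < M)%N -> horizontal L a2 a1 e = ~~ horizontal L a1 a2 (M.-1 - e)%N.
  by move=> /dM; apply: horizontal_rev.
suff nb : ~~ bwd_blocked a1 a2 b B (M - X) (M - E).
  move/negP: nb; apply; apply/bwd_blockedP => Z hZ; move/fwd_blockedP: fwd => /(_ (M - Z)%N).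
  have -> : count_in (mem_cyc (rev_set B)) E (M - Z) = count_in (mem_cyc B) Z (M - E).
    rewrite (@eq_count_in _ (fun e => mem_cyc B (M.-1 - e)%N)) => [|i hi]; last by apply: eB; lia.
    by rewrite count_in_rev ?subKn //; lia.
  have -> : countV L a2 a1 E (M - Z) = countH L a1 a2 Z (M - E).
    rewrite /countV (@eq_count_in _ (fun e => horizontal L a1 a2 (M.-1 - e)%N)) => [|i hi].
      by rewrite count_in_rev ?subKn //; lia.
    by rewrite eh ?negbK //; lia.
  by apply; lia.
apply: comp.
- lia.
- have -> : (M - X = M.-1 - X.-1)%N by lia.
  by rewrite -eA //; lia.
- have -> : ((M - E).-1 = M.-1 - E)%N by lia.
  by rewrite -eB //; lia.
- apply/fwd_blockedP => Z hZ; move/bwd_blockedP: bwd => /(_ (M - Z)%N).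
  have -> : count_in (mem_cyc (rev_set A)) (M - Z) X = count_in (mem_cyc A) (M - X) Z.
    rewrite (@eq_count_in _ (fun e => mem_cyc A (M.-1 - e)%N)) => [|i hi]; last by apply: eA; lia.
    by rewrite count_in_rev ?subKn //; lia.
  have -> : countH L a2 a1 (M - Z) X = countV L a1 a2 (M - X) Z.
    rewrite /countH (@eq_count_in _ (fun e => ~~ horizontal L a1 a2 (M.-1 - e)%N)) => [|i hi];
      last by apply: eh; lia.
    by rewrite (count_in_rev (fun e => ~~ horizontal L a1 a2 e)) ?subKn //; lia.
  by apply; lia.
Qed.
End Reversal.

Lemma compatible_rev L a1 a2 b c (A B : {set 'I_L}) : L = (a1 + a2)%N ->
  compatible a2 a1 c b (rev_set B) (rev_set A) = compatible a1 a2 b c A B.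
Proof.
move=> L_sum; apply/idP/idP; last exact: compatible_rev1.
by move=> h; rewrite -[A]rev_setK -[B]rev_setK; apply: compatible_rev1; rewrite // addnC.
Qed.

Lemma rev_set_horizontals L a1 a2 (B : {set 'I_L}) : L = (a1 + a2)%N ->
  (rev_set B \subset horizontals L a2 a1) = (B \subset verticals L a1 a2).
Proof.
move=> L_sum.
have e i : (rev_ord i \in horizontals L a2 a1) = (i \in verticals L a1 a2).
  rewrite !inE (horizontal_rev L_sum (e := i)) //; have := ltn_ord i => /= lt; first by lia.
  by rewrite -addnS subnSK // subnKC // ltnW.
apply/subsetP/subsetP => h i iB.
  by rewrite -e h // mem_rev_set rev_ordK.
by rewrite -[i]rev_ordK e h // -mem_rev_set.
Qed.

Lemma rev_set_verticals L a1 a2 (A : {set 'I_L}) : L = (a1 + a2)%N ->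
  (rev_set A \subset verticals L a2 a1) = (A \subset horizontals L a1 a2).
Proof.
by move=> L_sum; rewrite -[A in RHS]rev_setK rev_set_horizontals // addnC.
Qed.

Lemma dyck_polyE L a1 a2 b c : dyck_poly L a1 a2 b c =
  \sum_(A : {set 'I_L}) \sum_(B : {set 'I_L} | [&& A \subset horizontals L a1 a2,
     B \subset verticals L a1 a2 & compatible a1 a2 b c A B])
    ('X^#|B|)%:P * 'X^#|A|.
Proof.
rewrite /dyck_poly big_mkcond /=; apply: eq_bigr => A _; rewrite powersetE.
case: ifP => _; last by rewrite big_pred0.
by apply: eq_bigl => B; rewrite powersetE.
Qed.

Lemma swapXY_dyck_poly L a1 a2 b c : L = (a1 + a2)%N ->
  swapXY (dyck_poly L a1 a2 b c) = dyck_poly L a2 a1 c b.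
Proof.
move=> L_sum; rewrite !dyck_polyE.
rewrite [RHS](reindex_inj (can_inj (@rev_setK L))) /=.
under [RHS]eq_bigr => A _ do rewrite (reindex_inj (can_inj (@rev_setK L))) /=.
rewrite [RHS](exchange_big_dep xpredT) //= raddf_sum; apply: eq_bigr => A _.
rewrite raddf_sum; apply: eq_big => B.
  by rewrite rev_set_horizontals // rev_set_verticals // compatible_rev // andbCA.
move=> _; rewrite [LHS]rmorphM /= swapXY_polyC !card_rev_set.
by rewrite map_polyXn rmorphXn /= swapXY_X rmorphXn /= mulrC.
Qed.

(** * Greedy recurrence from row and column factorizations *)

(** The coefficients of (1 + X)^-n. *)
Definition negbin (n k : nat) : int := (-1) ^+ k * 'C(n + k - 1, k)%:Z.

Lemma negbin0 n : negbin n 0 = 1.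
Proof. by rewrite /negbin bin0 expr0 mul1r. Qed.

Lemma negbin0S k : negbin 0 k.+1 = 0.
Proof. by rewrite /negbin add0n subn1 bin_small ?mulr0. Qed.

Lemma negbinS n k : negbin n.+1 k.+1 = negbin n k.+1 - negbin n.+1 k.
Proof.
rewrite /negbin addnS subn1 /= addSn binS PoszD mulrDr; congr (_ + _).
  by rewrite addnS subn1.
by rewrite subn1 /= exprS mulN1r mulNr.
Qed.

(** Division by (1 + X^b)^n in terms of coefficients.  The number of terms K is free:
    every index k with b k > j contributes 0. *)
Lemma coef_quotient b n (D : {poly int}) K j : (0 < b)%N -> (j < K)%N ->
  D`_j = \sum_(k < K) negbin n k *
    (if (b * k <= j)%N then ((1 + 'X^b) ^+ n * D)`_(j - b * k) else 0).
Proof.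
move=> b0; elim: n D K j => [|n IHn] D K j.
  case: K => // K _; rewrite expr0 mul1r big_ord_recl negbin0 muln0 leq0n subn0 mul1r.
  by rewrite big1 ?addr0 // => i _; rewrite negbin0S mul0r.
elim/ltn_ind: j K => j IHj [//|K] jK.
set P := (1 + 'X^b) ^+ n.+1 * D.
have PE : P = (1 + 'X^b) ^+ n * ((1 + 'X^b) * D) by rewrite /P exprSr mulrA.
have := IHn ((1 + 'X^b) * D) K.+1 j jK; rewrite -PE.
rewrite mulrDl mul1r coefD coefXnM !big_ord_recl !negbin0 => e.
have {e} -> : D`_j = 1 * (if (b * 0 <= j)%N then P`_(j - b * 0) else 0) +
    \sum_(i < K) negbin n (lift ord0 i) *
       (if (b * lift ord0 i <= j)%N then P`_(j - b * lift ord0 i) else 0) -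
    (if (j < b)%N then 0 else D`_(j - b)) by rewrite -e addrK.
rewrite -addrA; congr (_ + _).
case: ltnP => jb.
  rewrite subr0; apply: eq_bigr => i _; rewrite lift0.
  by have -> : (b * i.+1 <= j)%N = false by [nia]; rewrite !mulr0.
rewrite (IHj (j - b)%N _ K) -/P; [|lia|lia].
rewrite -sumrB; apply: eq_bigr => i _; rewrite lift0.
have -> : (b * i <= j - b)%N = (b * i.+1 <= j)%N by rewrite mulnS; lia.
case: leqP => h; last by rewrite !mulr0 subr0.
have -> : (j - b - b * i = j - b * i.+1)%N by rewrite mulnS; lia.
by rewrite -mulrBl -negbinS.
Qed.

(** One of the two alternating sums in the greedy recurrence, for the row or column
    u and with n in place of the positive part of the integer in the binomial. *)
Definition greedy_sum (n : nat) (u : nat -> int) (p : nat) : int :=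
  \sum_(1 <= k < p.+1) (-1) ^+ (k - 1)%N * u (p - k)%N * 'C(n + k - 1, k)%:Z.

Lemma greedy_sum_negbin n u p :
  u p - greedy_sum n u p = \sum_(k < p.+1) negbin n k * u (p - k)%N.
Proof.
rewrite big_ord_recl negbin0 mul1r subn0; congr (_ + _).
rewrite /greedy_sum big_add1 /= big_mkord -sumrN; apply: eq_bigr => i _.
by rewrite /bump /= add1n /negbin !subn1 /= exprS mulN1r !mulNr mulrAC.
Qed.

Lemma coef_quotient_greedy n (D : {poly int}) p :
  D`_p = ((1 + 'X) ^+ n * D)`_p - greedy_sum n (fun i => ((1 + 'X) ^+ n * D)`_i) p.
Proof.
rewrite (@coef_quotient 1 n D p.+1 p) // expr1.
rewrite (greedy_sum_negbin n (fun i => ((1 + 'X) ^+ n * D)`_i)).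
by apply: eq_bigr => k _; rewrite mul1n -ltnS ltn_ord.
Qed.

Lemma greedy_sum0 u p : greedy_sum 0 u p = 0.
Proof.
rewrite /greedy_sum big_nat big1 // => k hk.
by rewrite bin_small ?mulr0 //; lia.
Qed.

Lemma greedy_sum_eq n u v p : (forall i, (i < p)%N -> u i = v i) ->
  greedy_sum n u p = greedy_sum n v p.
Proof.
by move=> uv; apply: eq_big_nat => k hk; rewrite uv //; lia.
Qed.

Section RowCol.

Variables b c a1 a2 : nat.
Implicit Types F : {poly {poly int}}.

Definition col_factor F e := row_factor c b a2 a1 (swapXY F) e.

Lemma row_factor_coef F d p q : row_factor b c a1 a2 F d ->
  (d q)`_p = F`_q`_p - greedy_sum (a2 - c * q) (fun i => F`_q`_i) p.
Proof. by case=> _ FE _; rewrite FE -coef_quotient_greedy. Qed.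

(** The bounds leave no room for a coefficient of d_q on the line b p a2 = c q a1 or
    on the side of it that contains the p-axis, except at the origin. *)
Lemma row_factor_vanish F d p q : (0 < c)%N -> row_factor b c a1 a2 F d ->
  (p, q) != (0, 0)%N -> (c * q * a1 <= b * p * a2)%N -> (d q)`_p = 0.
Proof.
move=> c0 [d0 _ dE] nz le; apply/eqP; apply/negPn/negP => dnz.
have [q0|q0] := posnP q.
  by move: dnz nz; rewrite q0 d0 coefC; case: (p) => //= n; rewrite eqxx.
have [h1 h2] := dE q p q0 dnz.
have [/h1|lt] := leqP (c * q) a2; first by nia.
have {h1 h2} h := h2 lt; have : (a2.+1 * a1 <= c * q * a1)%N by rewrite leq_mul2r lt orbT.
move: le h {lt}; move: (b * p)%N (c * q * a1)%N => x y; nia.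
Qed.

Lemma row_factor_eq F d p q : (0 < c)%N -> row_factor b c a1 a2 F d ->
  (p, q) != (0, 0)%N -> (c * q * a1 <= b * p * a2)%N ->
  F`_q`_p = greedy_sum (a2 - c * q) (fun i => F`_q`_i) p.
Proof.
move=> c0 rF nz le; apply/eqP; rewrite -subr_eq0 -(row_factor_coef _ _ rF).
by rewrite (row_factor_vanish c0 rF).
Qed.
End RowCol.

Lemma swap_pair_neq0 p q : ((q, p) != (0, 0))%N = ((p, q) != (0, 0))%N.
Proof. by rewrite !xpair_eqE andbC. Qed.

Lemma col_factor_eq b c a1 a2 F e p q : (0 < b)%N -> col_factor b c a1 a2 F e ->
  (p, q) != (0, 0)%N -> (b * p * a2 <= c * q * a1)%N ->
  F`_q`_p = greedy_sum (a1 - b * p) (fun i => F`_i`_p) q.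
Proof.
move=> b0 cF; rewrite -swap_pair_neq0 => nz le.
have := row_factor_eq b0 cF nz le; rewrite coef_swapXY => ->.
by apply: greedy_sum_eq => i _; rewrite coef_swapXY.
Qed.

(** Every nonzero (p, q) lies on one side of the line b p a2 = c q a1, where the row
    or the column relation expresses the coefficient through earlier ones. *)
Lemma factor_unique b c a1 a2 F d e F' d' e' : (0 < b)%N -> (0 < c)%N ->
  row_factor b c a1 a2 F d -> col_factor b c a1 a2 F e ->
  row_factor b c a1 a2 F' d' -> col_factor b c a1 a2 F' e' -> F = F'.
Proof.
move=> b0 c0 rF cF rF' cF'.
suff eqF n p q : (p + q < n)%N -> F`_q`_p = F'`_q`_p.
  by apply/polyP => q; apply/polyP => p; apply: (eqF (p + q).+1).
elim: n p q => // n IH p q pq.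
have [[-> ->]|nz] := eqVneq (p, q) (0, 0)%N.
  have [d0 h _] := rF; have [d0' h' _] := rF'.
  by rewrite h h' d0 d0'.
have [le|/ltnW le] := leqP (c * q * a1) (b * p * a2).
  rewrite (row_factor_eq c0 rF nz le) (row_factor_eq c0 rF' nz le).
  by apply: greedy_sum_eq => i ip; apply: IH; lia.
rewrite (col_factor_eq b0 cF nz le) (col_factor_eq b0 cF' nz le).
by apply: greedy_sum_eq => i ip; apply: IH; lia.
Qed.

(** The differences between a coefficient and its two sums are coefficients of the
    quotients of the row and of the column: both are nonnegative, and one of them
    vanishes. *)
Lemma factor_greedy b c a1 a2 F d e p q : (0 < b)%N -> (0 < c)%N ->
  row_factor b c a1 a2 F d -> (forall q p, 0 <= (d q)`_p) ->
  col_factor b c a1 a2 F e -> (forall p q, 0 <= (e p)`_q) ->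
  (p, q) != (0, 0)%N ->
  F`_q`_p = Num.max (greedy_sum (a2 - c * q) (fun i => F`_q`_i) p)
                    (greedy_sum (a1 - b * p) (fun i => F`_i`_p) q).
Proof.
move=> b0 c0 rF dp cF ep nz.
have le1 : greedy_sum (a2 - c * q) (fun i => F`_q`_i) p <= F`_q`_p.
  by rewrite -subr_ge0 -(row_factor_coef _ _ rF).
have le2 : greedy_sum (a1 - b * p) (fun i => F`_i`_p) q <= F`_q`_p.
  rewrite -subr_ge0; have := row_factor_coef q p cF; rewrite coef_swapXY.
  rewrite (@greedy_sum_eq _ _ (fun i => F`_i`_p)) => [<- //|i _].
  by rewrite coef_swapXY.
have [le|/ltnW le] := leqP (c * q * a1) (b * p * a2).
  by rewrite (max_idPl _) // -(row_factor_eq c0 rF nz le).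
by rewrite (max_idPr _) // -(col_factor_eq b0 cF nz le).
Qed.

(** * A filtration by divisibility *)

Lemma size_1X : size (1 + 'X : {poly int}) = 2.
Proof. by rewrite addrC -[1]polyC1 size_XaddC. Qed.

Lemma monic_1X : (1 + 'X : {poly int}) \is monic.
Proof. by rewrite addrC -[1]polyC1 monicXaddC. Qed.

Lemma pow1X_neq0 n : (1 + 'X : {poly int}) ^+ n != 0.
Proof. by rewrite monic_neq0 // monic_exp // monic_1X. Qed.

Lemma size_pow1X_mul n (D : {poly int}) : D != 0 ->
  size ((1 + 'X) ^+ n * D) = (n + size D)%N.
Proof.
move=> D0; rewrite size_monicM ?monic_exp ?monic_1X //.
have := size_exp (1 + 'X : {poly int}) n; rewrite size_1X /= mul1n.
have := pow1X_neq0 n; rewrite -size_poly_eq0 -lt0n.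
by move: (size _) (size D) => x y; lia.
Qed.

Lemma coef_pow1X n i : ((1 + 'X : {poly int}) ^+ n)`_i = 'C(n, i)%:Z.
Proof.
elim: n i => [|n IH] i; first by rewrite expr0 coefC; case: i.
rewrite exprS mulrDl mul1r coefD coefXM !IH; case: i => [|i] /=.
  by rewrite !bin0 addr0.
by rewrite binS PoszD.
Qed.

Lemma coef0_pow1X_mul n (D : {poly int}) : ((1 + 'X) ^+ n * D)`_0 = D`_0.
Proof. by rewrite coefM big_ord1 subn0 coef_pow1X bin0 mul1r. Qed.

Lemma coef_pow1X_mul_neq0 n (D : {poly int}) q : ((1 + 'X) ^+ n * D)`_q != 0 ->
  exists r, [/\ D`_r != 0, (r <= q)%N & (q <= n + r)%N].
Proof.
rewrite coefM => nz.
have [/existsP[i h]|/existsPn h] := boolP [exists i : 'I_q.+1,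
    ((1 + 'X : {poly int}) ^+ n)`_i * D`_(q - i) != 0]; last first.
  by rewrite big1 ?eqxx in nz => // i _; apply/eqP; have := h i; rewrite negbK.
move: h; rewrite mulf_eq0 negb_or => /andP[h1 h2]; exists (q - i)%N; split=> //.
  exact: leq_subr.
move: h1; rewrite coef_pow1X; case: (leqP i n) => [le _|lt]; last by rewrite bin_small.
by have := ltn_ord i; lia.
Qed.

Lemma top_coef_pow1X_mul n (D : {poly int}) r : D`_r != 0 ->
  exists2 j, (n + r <= j)%N & ((1 + 'X) ^+ n * D)`_j != 0.
Proof.
move=> nz; have D0 : D != 0 by apply: contraNneq nz => ->; rewrite coef0.
have rD : (r < size D)%N by rewrite ltnNge; apply: contra nz => /leq_sizeP ->.
have sP := size_pow1X_mul n D0.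
exists (n + size D).-1; first by lia.
by rewrite -sP -[_`_ _]/(lead_coef _) lead_coef_eq0 mulf_neq0 ?pow1X_neq0.
Qed.

Definition div_pow1X (n : nat) (P : {poly int}) := exists e, P = (1 + 'X) ^+ n * e.

Lemma div_pow1X_add n P Q : div_pow1X n P -> div_pow1X n Q -> div_pow1X n (P + Q).
Proof. by case=> e -> [f ->]; exists (e + f); rewrite mulrDr. Qed.

Lemma div_pow1X_opp n P : div_pow1X n P -> div_pow1X n (- P).
Proof. by case=> e ->; exists (- e); rewrite mulrN. Qed.

Lemma div_pow1X_0 n : div_pow1X n 0.
Proof. by exists 0; rewrite mulr0. Qed.

Lemma div_pow1X_sum n (I : Type) (s : seq I) (p : pred I) F :
  (forall i, p i -> div_pow1X n (F i)) -> div_pow1X n (\sum_(i <- s | p i) F i).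
Proof.
by move=> h; apply: big_ind => //; [apply: div_pow1X_0 | apply: div_pow1X_add].
Qed.

Lemma div_pow1X_mul m n k P Q : (k <= m + n)%N ->
  div_pow1X m P -> div_pow1X n Q -> div_pow1X k (P * Q).
Proof.
move=> le [e ->] [f ->]; exists ((1 + 'X) ^+ (m + n - k) * (e * f)).
by rewrite mulrACA -exprD [RHS]mulrA -exprD subnKC.
Qed.

Lemma div_pow1X_triv P : div_pow1X 0 P.
Proof. by exists P; rewrite mul1r. Qed.

Section Filtration.

Variable b : nat.
Hypothesis b_gt0 : (0 < b)%N.
Implicit Types G H : {poly {poly int}}.

(** With t of weight b and 1 + s of weight 1, this is the ideal of polynomials of
    weight at least n; here t is the outer variable.  For n = a1 it expresses the
    divisibility of the columns of a polynomial pointed at (a1, a2), in a form that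
    is multiplicative. *)
Definition weight_ge n G := forall p, div_pow1X (n - b * p) G`_p.

Lemma weight_ge_add n G H : weight_ge n G -> weight_ge n H -> weight_ge n (G + H).
Proof. by move=> g h p; rewrite coefD; apply: div_pow1X_add. Qed.

Lemma weight_ge_0 n : weight_ge n 0.
Proof. by move=> p; rewrite coef0; apply: div_pow1X_0. Qed.

Lemma weight_ge_sum n (I : Type) (s : seq I) (P : pred I) F :
  (forall i, P i -> weight_ge n (F i)) -> weight_ge n (\sum_(i <- s | P i) F i).
Proof. by move=> h; apply: big_ind => //; [apply: weight_ge_0 | apply: weight_ge_add]. Qed.

Lemma weight_ge_mul m n k G H : (k <= m + n)%N ->
  weight_ge m G -> weight_ge n H -> weight_ge k (G * H).
Proof.
move=> le g h p; rewrite coefM; apply: div_pow1X_sum => i _.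
apply: div_pow1X_mul (g i) (h (p - i)%N).
have : (b * p = b * i + b * (p - i))%N by rewrite -mulnDr subnKC // -ltnS.
lia.
Qed.

Lemma weight_ge_triv G : weight_ge 0 G.
Proof. by move=> p; rewrite sub0n; apply: div_pow1X_triv. Qed.

Lemma weight_ge_mull n G H : weight_ge n H -> weight_ge n (G * H).
Proof. by move=> h; apply: weight_ge_mul (weight_ge_triv G) h. Qed.

Lemma weight_ge_exp n G : weight_ge 1 G -> weight_ge n (G ^+ n).
Proof.
move=> g; elim: n => [|n IH]; first exact: weight_ge_triv.
by rewrite exprS; apply: weight_ge_mul g IH; rewrite add1n.
Qed.

Lemma weight_ge_Xn p : weight_ge (b * p) 'X^p.
Proof.
move=> i; rewrite coefXn; case: eqP => [->|_]; last exact: div_pow1X_0.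
by rewrite subnn; apply: div_pow1X_triv.
Qed.

(** Cancelling 1 + t, a polynomial of weight 0 with constant term 1, does not lower
    the weight. *)
Lemma weight_ge_div n M G : weight_ge n ((1 + 'X) ^+ M * G) -> weight_ge n G.
Proof.
elim: M => [|M IH]; first by rewrite expr0 mul1r.
rewrite exprS -mulrA => h; apply: IH.
move: (_ * G) h => {G} G h; elim=> [|p IHp].
  by have := h 0%N; rewrite mulrDl mul1r coefD coefXM addr0.
have := h p.+1; rewrite mulrDl mul1r coefD coefXM /= => hp.
rewrite -[G`_p.+1](addrK G`_p); apply: div_pow1X_add hp _; apply: div_pow1X_opp.
rewrite -[G`_p]mul1r; apply: div_pow1X_mul (div_pow1X_triv _) IHp.
by rewrite mulnS; lia.
Qed.

Variable c : nat.

(** The homogenization s^N Q(w / s) of a polynomial Q of degree at most N, at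
    w = (1 + t)^c. *)
Definition hom_poly (N : nat) (Q : {poly int}) : {poly {poly int}} :=
  \sum_(q < N.+1) (Q`_q)%:P%:P * (1 + 'X) ^+ (c * q) * 'X%:P ^+ (N - q).

Lemma homog_1X N (e : {poly int}) : (size e <= N.+1)%N ->
  hom_poly N.+1 ((1 + 'X) * e) = ('X%:P + (1 + 'X) ^+ c) * hom_poly N e.
Proof.
move=> se; rewrite [RHS]mulrDl /hom_poly !mulr_sumr.
under eq_bigr => q _ do rewrite mulrDl mul1r coefD coefXM !polyCD !mulrDl.
rewrite big_split /=; congr (_ + _).
  rewrite big_ord_recr /= (nth_default _ se) !polyC0 !mul0r addr0.
  apply: eq_bigr => q _; rewrite subSn; last by rewrite -ltnS.
  by rewrite exprS mulrCA.
rewrite big_ord_recl /= !polyC0 !mul0r add0r; apply: eq_bigr => q _.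
by rewrite /bump /= add1n subSS mulnS exprD !mulrA [_%:P%:P * _]mulrC.
Qed.

Lemma homog_pow1X N n (e : {poly int}) : (size e <= N.+1)%N ->
  hom_poly (n + N) ((1 + 'X) ^+ n * e) = ('X%:P + (1 + 'X) ^+ c) ^+ n * hom_poly N e.
Proof.
move=> se; elim: n => [|n IH]; first by rewrite !expr0 !mul1r.
rewrite addSn !exprS -!mulrA -IH homog_1X //.
have [->|e0] := eqVneq e 0; first by rewrite mulr0 size_poly0.
by rewrite size_pow1X_mul //; lia.
Qed.

(** Homogenizing 1 + s gives s + (1 + t)^c, which is 1 + s up to multiples of t. *)
Lemma weight_ge_homog_base : weight_ge 1 ('X%:P + (1 + 'X) ^+ c : {poly {poly int}}).
Proof.
move=> p; rewrite coefD coefC; case: p => [|p] /=.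
  have -> : ((1 + 'X : {poly {poly int}}) ^+ c)`_0 = 1.
    by rewrite -horner_coef0 horner_exp hornerD hornerX hornerC addr0 expr1n.
  by exists 1; rewrite muln0 subn0 expr1 mulr1 addrC.
by have -> : (1 - b * p.+1 = 0)%N by [nia]; apply: div_pow1X_triv.
Qed.

Lemma weight_ge_hom_poly N p (Q : {poly int}) : (size Q <= N.+1)%N -> div_pow1X (N - b * p) Q ->
  weight_ge N ('X^p * hom_poly N Q).
Proof.
move=> sQ [e eQ]; set k := (N - b * p)%N in eQ.
have kN : (k <= N)%N by rewrite leq_subr.
apply: (weight_ge_mul _ (weight_ge_Xn p) (_ : weight_ge k _)); first by rewrite /k; lia.
rewrite eQ -(subnKC kN) homog_pow1X; last first.
  have [->|e0] := eqVneq e 0; first by rewrite size_poly0.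
  by move: sQ; rewrite eQ size_pow1X_mul //; lia.
by rewrite mulrC; apply: weight_ge_mull; apply: weight_ge_exp; apply: weight_ge_homog_base.
Qed.

(** Homogenization turns a factor (1 + s)^k into (s + (1 + t)^c)^k, which has the
    same weight. *)
Lemma weight_ge_homogenize N (F : {poly {poly int}}) : (size F <= N.+1)%N ->
  weight_ge N (swapXY F) ->
  weight_ge N (\sum_(q < N.+1) 'X%:P ^+ (N - q) * (1 + 'X) ^+ (c * q) * map_poly polyC F`_q).
Proof.
move=> sF fF.
have -> : \sum_(q < N.+1) 'X%:P ^+ (N - q) * (1 + 'X) ^+ (c * q) * map_poly polyC F`_q
    = \sum_(p < size (swapXY F)) 'X^p * hom_poly N (swapXY F)`_p.
  rewrite /hom_poly; under [RHS]eq_bigr => p _ do rewrite mulr_sumr.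
  rewrite exchange_big /=; apply: eq_bigr => q _.
  have -> : map_poly polyC F`_q = \poly_(p < size (swapXY F)) (F`_q`_p)%:P.
    apply/polyP => p; rewrite coef_map coef_poly /=; case: ltnP => // sp.
    by rewrite -coef_swapXY (nth_default 0 sp) coef0.
  rewrite poly_def mulr_sumr; apply: eq_bigr => p _.
  by rewrite coef_swapXY -mul_polyC; ring.
apply: weight_ge_sum => p _; apply: weight_ge_hom_poly (fF p).
apply/leq_sizeP => q hq; rewrite coef_swapXY.
by rewrite (nth_default 0 (leq_trans sF hq)) coef0.
Qed.
End Filtration.

(** * Mutation of the factorizations *)

Section Mutation.

Variables (b c a1 n m k : nat) (F : {poly {poly int}}) (d e : nat -> {poly int}).
Hypotheses (b_gt0 : (0 < b)%N) (c_gt0 : (0 < c)%N) (a1_gt0 : (0 < a1)%N).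
Hypotheses (m_gt0 : (0 < m)%N) (nm : (n + m = c * a1 + k)%N).
Hypothesis nk0 : n = 0%N \/ k = 0%N.
Hypotheses (rF : row_factor b c a1 n F d) (cF : col_factor b c a1 n F e).

Lemma col_coef p q : F`_q`_p = ((1 + 'X) ^+ (a1 - b * p) * e p)`_q.
Proof. by have [_ h _] := cF; rewrite -h coef_swapXY. Qed.

Lemma col0_coef q : F`_q`_0 = 'C(a1, q)%:Z.
Proof.
by rewrite col_coef muln0 subn0; have [-> _ _] := cF; rewrite mulr1 coef_pow1X.
Qed.

Lemma col_support p q : F`_q`_p != 0 -> (0 < p)%N ->
  exists2 r, (r <= q <= a1 - b * p + r)%N &
    ((b * p <= a1)%N -> (c * r * a1 < b * p * n)%N) /\ ((a1 < b * p)%N -> (c * r < n)%N).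
Proof.
move=> nz p0; move: nz; rewrite col_coef => /coef_pow1X_mul_neq0[r [er rq qr]].
by exists r; [lia | have [_ _ /(_ p r p0 er)] := cF].
Qed.

Lemma n_le : (n <= c * a1)%N.
Proof. by case: nk0; lia. Qed.

Lemma row_ge q p : (n <= c * q)%N -> (d q)`_p = F`_q`_p.
Proof.
by move=> h; have [_ -> _] := rF; rewrite (eqP h) expr0 mul1r.
Qed.

(** The column bounds, in the form that the mutated rows need: above the corner
    (a1 / b, n / c) of the region, a point of the support with p > 0 lies strictly
    below the line from that corner to (0, a1). *)
Lemma support_le p q : F`_q`_p != 0 -> (0 < p)%N -> (q < a1)%N /\
  ((n <= c * q)%N -> (0 < n)%N /\ (b * p <= a1)%N /\ (c * q * a1 + b * p * m < c * a1 * a1)%N).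
Proof.
move=> nz p0; have [r rq [h1 h2]] := col_support nz p0; have nle := n_le.
have [le|lt] := leqP (b * p) a1; last first.
  have := h2 lt; split; first by nia.
  have : (c * r * 1 < c * a1)%N by lia.
  have : (c * q <= c * r)%N by rewrite leq_mul2l; apply/orP; right; lia.
  by lia.
have {h1 h2} h := h1 le.
have n0 : (0 < n)%N by case: (n) h => //; lia.
have k0 : k = 0%N by case: nk0 => //; lia.
have rbp : (r < b * p)%N.
  have : (c * a1 * r < c * a1 * (b * p))%N by nia.
  by rewrite ltn_pmul2l // muln_gt0 c_gt0.
split; first by lia.
move=> _; split=> //; split=> //.
have : (c * q * a1 <= c * a1 * (a1 - b * p + r))%N by nia.
have : (c * a1 * (a1 - b * p + r) + c * a1 * (b * p) = c * a1 * a1 + c * a1 * r)%N by nia.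
nia.
Qed.

Lemma size_F : (size F <= a1.+1)%N.
Proof.
apply/leq_sizeP => q hq; apply/polyP => p; rewrite coef0; apply/eqP/negPn/negP => nz.
have [p0|p0] := posnP p; last by have [] := support_le nz p0; lia.
by move: nz; rewrite p0 col0_coef bin_small.
Qed.

Lemma row_bound q p : (d q)`_p != 0 -> (0 < p)%N -> (c * q <= n)%N -> (b * p * n < c * q * a1)%N.
Proof.
move=> nz p0 le; have [d0 _ h] := rF; have [q0|q0] := posnP q.
  by move: nz; rewrite q0 d0 coefC; case: (p) p0 => //= x _; rewrite eqxx.
by have [] := h q p q0 nz; auto.
Qed.

(** Substituting (1 + t) / x2 for x2 turns x2^-(a2 - cq) (1 + t)^[a2 - cq]_+ into
    x2^(a2 - cq) (1 + t)^[cq - a2]_+.  Since a2 - cq = - (a2' - c (a1 - q)) for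
    a2' = c a1 - a2, this is row a1 - q of an expression of the same shape: mutation
    only reverses the order of the quotients. *)
Definition mut_quot (j : nat) : {poly int} := if (j < a1.+1)%N then d (a1 - j)%N else 0.

Definition mut_poly : {poly {poly int}} :=
  \poly_(j < a1.+1) ((1 + 'X) ^+ (m - c * j) * d (a1 - j)%N).

Lemma coef_mut_poly j : mut_poly`_j = (1 + 'X) ^+ (m - c * j) * mut_quot j.
Proof. by rewrite coef_poly /mut_quot; case: ifP; rewrite ?mulr0. Qed.

(** The bounds for the reversed quotients are the column bounds of F where
    n <= c q, and its row bounds elsewhere. *)
Lemma mut_row : row_factor b c a1 m mut_poly mut_quot.
Proof.
have nle := n_le; split; last 1 first.
- move=> j r j0; rewrite /mut_quot; case: ltnP => [ja|_]; last by rewrite coef0 eqxx.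
  set q := (a1 - j)%N => nz.
  have eq : (c * q + c * j = c * a1)%N by rewrite -mulnDr; congr (_ * _)%N; lia.
  have cja : (0 < c * j * a1)%N by rewrite !muln_gt0 c_gt0 j0.
  have [r0|r0] := posnP r; first by rewrite r0; split; lia.
  split=> h.
    have nq : (n <= c * q)%N by case: nk0 => *; lia.
    by move: nz; rewrite row_ge // => /support_le/(_ r0)[_ /(_ nq)]; nia.
  have k0 : k = 0%N.
    by case: nk0 => // n0; lia.
  have qn : (c * q <= n)%N by lia.
  have := row_bound nz r0 qn.
  have : (c * q * a1 <= n * a1)%N by rewrite leq_mul2r qn orbT.
  nia.
- rewrite /mut_quot /= subn0; apply/polyP => p; rewrite row_ge // coefC.
  case: p => [|p]; first by rewrite col0_coef binn.
  by apply/eqP/negPn/negP => /support_le/(_ isT)[]; rewrite ltnn.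
- exact: coef_mut_poly.
Qed.

(** Up to powers of 1 + t, the reversed polynomial is the homogenization of F. *)
Lemma mut_col_weight_ge : weight_ge b a1 (swapXY mut_poly).
Proof.
have fF : weight_ge b a1 (swapXY F).
  by move=> p; have [_ h _] := cF; rewrite h; exists (e p).
apply: (weight_ge_div b_gt0 (M := n)).
have := weight_ge_homogenize b_gt0 c size_F fF; set H := \sum_(q < _) _ => fH.
suff -> : (1 + 'X) ^+ n * swapXY mut_poly = (1 + 'X) ^+ k * H by apply: weight_ge_mull.
rewrite /mut_poly poly_def raddf_sum !mulr_sumr (reindex_inj rev_ord_inj) /=.
apply: eq_bigr => q _; rewrite subSS subKn; last by rewrite -ltnS.
rewrite -mul_polyC rmorphM /= swapXY_polyC rmorphXn /= swapXY_X.
have [_ -> _] := rF; rewrite !rmorphM !rmorphXn !rmorphD !rmorph1 /= map_polyX.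
set D := map_poly _ _; set Y := 'X%:P ^+ _; set T := 1 + 'X.
transitivity (Y * (T ^+ (n + (m - c * (a1 - q))) * D)); first by rewrite exprD; ring.
have -> : (n + (m - c * (a1 - q)) = k + (c * q + (n - c * q)))%N.
  have : (c * (a1 - q) + c * q = c * a1)%N by rewrite -mulnDr subnK // -ltnS.
  by case: nk0 => e0; lia.
by rewrite !exprD; ring.
Qed.

(** The degree of a column quotient is read off the highest monomial of that column,
    and the row bounds of F locate this monomial. *)
Lemma mut_col : exists e', col_factor b c a1 m mut_poly e'.
Proof.
have ex p : exists f, (swapXY mut_poly)`_p == (1 + 'X) ^+ (a1 - b * p) * f.
  by have [f ->] := mut_col_weight_ge p; exists f.
have [e' e'E] : exists e', forall p, (swapXY mut_poly)`_p = (1 + 'X) ^+ (a1 - b * p) * e' p.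
  by exists (fun p => xchoose (ex p)) => p; apply/eqP/(xchooseP (ex p)).
exists e'; split=> //.
- apply: (mulfI (pow1X_neq0 a1)); have := e'E 0%N; rewrite muln0 subn0 => <-.
  rewrite mulr1; apply/polyP => j; rewrite coef_swapXY coef_mut_poly coef0_pow1X_mul.
  rewrite coef_pow1X /mut_quot; case: ltnP => ja; last by rewrite coef0 bin_small.
  have [_ rE _] := rF; have := col0_coef (a1 - j); rewrite rE coef0_pow1X_mul => ->.
  by rewrite bin_sub.
- move=> p r p0 /(top_coef_pow1X_mul (a1 - b * p))[j jr].
  rewrite -e'E coef_swapXY coef_mut_poly /mut_quot.
  case: ltnP => [ja|_]; last by rewrite mulr0 coef0 eqxx.
  set q := (a1 - j)%N => nz.
  have eq : (c * q + c * j = c * a1)%N by rewrite -mulnDr; congr (_ * _)%N; lia.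
  have nle := n_le.
  have crq : (b * p <= a1)%N -> (c * r * a1 + c * q * a1 <= c * a1 * (b * p))%N.
    by move=> h; rewrite -mulnDl -mulnDr mulnAC leq_mul2l; apply/orP; right; lia.
  have bpm : (b * p * m + b * p * n = c * a1 * (b * p) + b * p * k)%N.
    by rewrite -mulnDr [(m + n)%N]addnC nm; lia.
  have crj : (a1 < b * p)%N -> (c * r <= c * j)%N.
    by move=> h; rewrite leq_mul2l; apply/orP; right; lia.
  (* In the first case the mutated row is the quotient itself; otherwise it keeps
     a positive power of 1 + t. *)
  have [le|lt] := leqP (c * q + k) n.
    have e0 : (m - c * j = 0)%N by lia.
    rewrite e0 expr0 mul1r in nz.
    have qn : (c * q <= n)%N by lia.
    have rb := row_bound nz p0 qn.
    split=> h; first by have := crq h; lia.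
    have : (c * q * a1 <= n * a1)%N by rewrite leq_mul2r qn orbT.
    by have := leq_mul (leqnn n) (ltnW h); lia.
  have [n0|n0] := posnP n; last first.
    have k0 : k = 0%N by case: nk0 => //; lia.
    split=> h; last by have := crj h; lia.
    have : (b * p * n <= a1 * n)%N by rewrite leq_mul2r h orbT.
    have : (n.+1 * a1 <= c * q * a1)%N by rewrite leq_mul2r orbC; apply/orP; left; lia.
    by have := crq h; lia.
  have [r0 [dr0 r0p pr0]] := coef_pow1X_mul_neq0 nz.
  have r00 : r0 = 0%N.
    have nq : (n <= c * q)%N by lia.
    have [//|r0_gt0] := posnP r0; move: dr0.
    by rewrite row_ge // => /support_le/(_ r0_gt0)[_ /(_ nq)]; lia.
  split=> h; last by have := crj h; lia.
  have := crq h; have : (0 < c * q * a1 + b * p * k)%N by rewrite addn_gt0 !muln_gt0; lia.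
  by rewrite n0 in bpm; lia.
Qed.

End Mutation.

Definition greedy_poly b c a1 a2 := dyck_poly (a1 + a2) a1 a2 b c.
Definition greedy_quot b c a1 a2 := row_quotient (a1 + a2) a1 a2 b c.

Lemma greedy_row b c a1 a2 : (0 < c)%N ->
  row_factor b c a1 a2 (greedy_poly b c a1 a2) (greedy_quot b c a1 a2).
Proof. by move=> c0; apply: dyck_row_factor. Qed.

Lemma swapXY_greedy b c a1 a2 :
  swapXY (greedy_poly b c a1 a2) = greedy_poly c b a2 a1.
Proof. by rewrite swapXY_dyck_poly // addnC. Qed.

Lemma greedy_col b c a1 a2 : (0 < b)%N ->
  col_factor b c a1 a2 (greedy_poly b c a1 a2) (greedy_quot c b a2 a1).
Proof. by move=> b0; rewrite /col_factor swapXY_greedy; apply: greedy_row. Qed.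

(** The extra parameter k covers the case where the mutated exponent exceeds c a1:
    then n = 0 stands for the positive part of the negative integer - k. *)
Lemma greedy_quot_mut b c a1 n m k q : (0 < b)%N -> (0 < c)%N -> (0 < a1)%N ->
  (0 < m)%N -> (n + m = c * a1 + k)%N -> n = 0%N \/ k = 0%N -> (q <= a1)%N ->
  greedy_quot b c a1 m (a1 - q) = greedy_quot b c a1 n q.
Proof.
move=> b0 c0 a0 m0 nm nk qa.
have rF := greedy_row b a1 n c0; have cF := greedy_col c a1 n b0.
have [e' cF'] := mut_col b0 c0 a0 m0 nm nk rF cF.
have rF' := mut_row b0 c0 a0 m0 nm nk rF cF.
have := factor_unique b0 c0 rF' cF' (greedy_row b a1 m c0) (greedy_col c a1 m b0).
move/(congr1 (fun G : {poly {poly int}} => G`_(a1 - q))); rewrite coef_mut_poly.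
have [_ -> _] := greedy_row b a1 m c0 => /(mulfI (pow1X_neq0 _)) <-.
by rewrite /mut_quot subKn // ifT //; lia.
Qed.

Lemma greedy_quot_big b c a1 a2 q : (a1 < q)%N -> greedy_quot b c a1 a2 q = 0.
Proof.
move=> aq; rewrite /greedy_quot /row_quotient big_pred0 // => A.
apply/negbTE/negP => /andP[]; rewrite powersetE => /subset_leq_card le /eqP Aq.
have L0 : (0 < a1 + a2)%N.
  have := subset_leq_card (subsetT A); rewrite cardsT card_ord Aq; lia.
by move: le; rewrite (card_horizontals (erefl _) L0) Aq; lia.
Qed.

(** * Greedy elements at all clusters *)

Section Evaluation.

Variable K : fieldType.
Implicit Types (u v : K) (F : {poly {poly int}}).

Definition ev1 u : {poly int} -> K := horner_eval u \o map_poly intr.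
HB.instance Definition _ u :=
  GRing.RMorphism.copy (ev1 u) (horner_eval u \o map_poly intr).

Definition ev2 u v : {poly {poly int}} -> K :=
  horner_eval u \o (horner_eval v%:P \o map_poly (map_poly intr)).
HB.instance Definition _ u v := GRing.RMorphism.copy (ev2 u v)
  (horner_eval u \o (horner_eval v%:P \o map_poly (map_poly intr))).

Lemma ev1X u : ev1 u 'X = u.
Proof. by rewrite /ev1 /= map_polyX /horner_eval hornerX. Qed.

Lemma ev2X u v : ev2 u v 'X = v.
Proof. by rewrite /ev2 /= map_polyX /horner_eval hornerX hornerC. Qed.

Lemma ev2C u v P : ev2 u v P%:P = ev1 u P.
Proof. by rewrite /ev2 /= map_polyC /horner_eval hornerC. Qed.

Lemma ev2_sum u v F N : (size F <= N)%N ->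
  ev2 u v F = \sum_(q < N) ev1 u F`_q * v ^+ q.
Proof.
move=> sF; rewrite -{1}[F]coefK (poly_def _ (fun q => F`_q)) raddf_sum /=.
rewrite (big_ord_widen N (fun q => ev2 u v (F`_q *: 'X^q))) // big_mkcond /=.
apply: eq_bigr => q _; case: ltnP => h.
  by rewrite -mul_polyC rmorphM rmorphXn /= ev2C ev2X.
by rewrite (nth_default _ h) raddf0 mul0r.
Qed.

Lemma ev2_swap u v F : ev2 u v (swapXY F) = ev2 v u F.
Proof. by rewrite /ev2 /= /horner_eval -swapXY_map horner2_swapXY. Qed.

Definition laurent_at (b c : nat) (a : int * int) F u v : K :=
  u ^ (- a.1) * v ^ (- a.2) * ev2 (u ^+ b) (v ^+ c) F.

Lemma laurent_at_swap b c a1 a2 F u v :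
  laurent_at b c (a1, a2) F u v = laurent_at c b (a2, a1) (swapXY F) v u.
Proof. by rewrite /laurent_at /= ev2_swap [v ^ _ * _]mulrC. Qed.

Definition pos_part (x : int) : nat := if x is Posz n then n else 0%N.

Lemma pos_partE x : (pos_part x)%:Z = Num.max x 0.
Proof. by case: x => n /=; lia. Qed.

Definition greedy_elt (b c : nat) (a : int * int) u v : K :=
  laurent_at b c a (greedy_poly b c (pos_part a.1) (pos_part a.2)) u v.

Lemma greedy_elt_swap b c a1 a2 u v :
  greedy_elt b c (a1, a2) u v = greedy_elt c b (a2, a1) v u.
Proof. by rewrite /greedy_elt laurent_at_swap swapXY_greedy. Qed.

Lemma greedy_quot_flip b c A a2 a2' q : (0 < b)%N -> (0 < c)%N ->
  a2 + a2' = (c * A)%:Z -> (q <= A)%N ->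
  greedy_quot b c A (pos_part a2') (A - q) = greedy_quot b c A (pos_part a2) q.
Proof.
move=> b0 c0 sa qA; have [A0|A0] := posnP A.
  move: qA; rewrite A0 leqn0 => /eqP->.
  have [-> _ _] := greedy_row b 0 (pos_part a2) c0.
  by have [-> _ _] := greedy_row b 0 (pos_part a2') c0.
have cA : (0 < c * A)%N by rewrite muln_gt0 c0.
have := pos_partE a2; have := pos_partE a2'; move: (pos_part a2) (pos_part a2') => n m em en.
have [m0|m0] := posnP m; last first.
  by apply: (@greedy_quot_mut b c A n m (n + m - c * A)) => //; lia.
rewrite -{2}(subKn qA); apply/esym.
by apply: (@greedy_quot_mut b c A m n (n + m - c * A)) => //; lia.
Qed.

(** Grouping by powers of v: each row contributes its quotient times
    v^-r (1 + u^b)^[r]_+ with r = a2 - cq, an expression that is symmetric under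
    r -> - r and v -> (1 + u^b) / v. *)
Lemma laurent_at_row b c a A d F u v : v != 0 -> (size F <= A.+1)%N ->
  (forall q, F`_q = (1 + 'X) ^+ (pos_part a.2 - c * q) * d q) ->
  laurent_at b c a F u v = u ^ (- a.1) * \sum_(q < A.+1) ev1 (u ^+ b) (d q) *
    (v ^ (- (a.2 - (c * q)%:Z)) * (1 + u ^+ b) ^+ pos_part (a.2 - (c * q)%:Z)).
Proof.
move=> v0 sF FE; rewrite /laurent_at -mulrA; congr (_ * _).
rewrite (ev2_sum _ _ sF) mulr_sumr; apply: eq_bigr => q _.
rewrite FE rmorphM rmorphXn rmorphD rmorph1 /= ev1X.
have -> : (pos_part a.2 - c * q)%N = pos_part (a.2 - (c * q)%:Z).
  by have := pos_partE a.2; have := pos_partE (a.2 - (c * q)%:Z); lia.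
rewrite -exprM opprB [_ - a.2]addrC expfzDr // -exprnP.
by ring.
Qed.

Lemma size_greedy_poly b c a1 a2 : (0 < c)%N -> (size (greedy_poly b c a1 a2) <= a1.+1)%N.
Proof.
move=> c0; apply/leq_sizeP => q hq; have [_ -> _] := greedy_row b a1 a2 c0.
by rewrite greedy_quot_big ?mulr0.
Qed.

Lemma greedy_elt_mutate b c a u v : (0 < b)%N -> (0 < c)%N ->
  v != 0 -> 1 + u ^+ b != 0 ->
  greedy_elt b c a u ((u ^+ b + 1) / v) =
  greedy_elt b c (a.1, (c * pos_part a.1)%:Z - a.2) u v.
Proof.
move=> b0 c0 v0 t0; rewrite /greedy_elt /=.
set A := pos_part a.1; rewrite addrC; set t := 1 + _ in t0 *.
have tv0 : t / v != 0 by rewrite mulf_neq0 ?invr_eq0.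
have [_ rE _] := greedy_row b A (pos_part a.2) c0.
rewrite (laurent_at_row _ _ tv0 (size_greedy_poly _ _ _ c0) rE).
set a2' := _ - a.2.
have [_ rE' _] := greedy_row b A (pos_part a2') c0.
rewrite (@laurent_at_row b c (a.1, a2') A _ _ u v v0 (size_greedy_poly _ _ _ c0) rE') /=.
congr (_ * _); rewrite [RHS](reindex_inj rev_ord_inj) /=; apply: eq_bigr => q _.
have qA : (q <= A)%N by rewrite -ltnS.
rewrite subSS (greedy_quot_flip b0 c0 (a2 := a.2)) //; last by rewrite /a2'; lia.
congr (_ * _).
have -> : a2' - (c * (A - q))%:Z = - (a.2 - (c * q)%:Z).
  have : (c * (A - q) + c * q = c * A)%N by rewrite -mulnDr subnK.
  by rewrite /a2'; lia.
move: (a.2 - _) => s; rewrite -/t opprK expfzMl exprz_inv opprK mulrAC mulrC.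
congr (_ * _); rewrite !exprnP -expfzDr //; congr (_ ^ _).
by have := pos_partE s; have := pos_partE (- s); lia.
Qed.

End Evaluation.

Section ClusterChange.

Variables b c : nat.
Hypotheses (b_gt0 : (0 < b)%N) (c_gt0 : (0 < c)%N).

Definition greedy_in (m : int) (a : int * int) : ratfun :=
  greedy_elt b c a (odd_var b c m) (even_var b c m).

Lemma odd_intS m : odd_int (m + 1) = ~~ odd_int m.
Proof. by rewrite /odd_int; case: m => [n|[|n]] //=; rewrite ?addn1 //= ?subn1 ?negbK. Qed.

Lemma exchange_add m :
  1 + cluster_var b c m ^+ exch_exp b c m != 0.
Proof.
by rewrite addrC -exchange_relation mulf_neq0 // cluster_var_neq0.
Qed.

Lemma next_cluster_var m : cluster_var b c (m + 1 + 1) =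
  (cluster_var b c (m + 1) ^+ exch_exp b c (m + 1) + 1) / cluster_var b c m.
Proof.
rewrite -exchange_relation addrK mulrAC divff ?mul1r //.
exact: cluster_var_neq0.
Qed.

Definition mutate_index (m : int) (a : int * int) : int * int :=
  if odd_int m then ((b * pos_part a.2)%:Z - a.1, a.2)
  else (a.1, (c * pos_part a.1)%:Z - a.2).

Lemma mutate_indexK m : involutive (mutate_index m).
Proof.
by move=> [a1 a2]; rewrite /mutate_index; case: odd_int => /=; rewrite subKr.
Qed.

Lemma greedy_in_succ m a : greedy_in (m + 1) a = greedy_in m (mutate_index m a).
Proof.
have nz := cluster_var_neq0 b c m; have t0 := exchange_add (m + 1).
have := next_cluster_var m; move: t0.
rewrite /greedy_in /odd_var /even_var /mutate_index /exch_exp odd_intS.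
case: odd_int => /= t0 ->.
  case: a => a1 a2 /=; rewrite greedy_elt_swap greedy_elt_mutate //.
  by rewrite [RHS]greedy_elt_swap.
by rewrite greedy_elt_mutate.
Qed.

Lemma greedy_in_pred m a : greedy_in m a = greedy_in (m + 1) (mutate_index m a).
Proof. by rewrite greedy_in_succ mutate_indexK. Qed.

Lemma greedy_in_any m n a : exists a', greedy_in m a = greedy_in n a'.
Proof.
have up k : forall i a, exists a', greedy_in i a = greedy_in (i + k%:Z) a'.
  elim: k => [|k IH] i a0; first by exists a0; rewrite addr0.
  have [a' ->] := IH i a0; exists (mutate_index (i + k%:Z) a').
  by rewrite greedy_in_pred; congr greedy_in; lia.
have down k : forall i a, exists a', greedy_in (i + k%:Z) a = greedy_in i a'.
  elim: k => [|k IH] i a0; first by exists a0; rewrite addr0.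
  have -> : i + k.+1%:Z = i + k%:Z + 1 by lia.
  by rewrite greedy_in_succ; apply: IH.
case: (leP m n) => h.
  have [a' ->] := up `|n - m|%N m a; exists a'; congr greedy_in; lia.
have [a' e] := down `|m - n|%N n a; exists a'; rewrite -e; congr greedy_in; lia.
Qed.

End ClusterChange.

(** * Membership in the cluster algebra and spanning *)

Lemma pos_part_subn (x : int) k : (pos_part x - k)%N = pos_part (x - k%:Z).
Proof. by have := pos_partE x; have := pos_partE (x - k%:Z); lia. Qed.

Section UpperBound.

Variables b c : nat.
Hypotheses (b_gt0 : (0 < b)%N) (c_gt0 : (0 < c)%N).
Implicit Types (a : int * int) (F G : {poly {poly int}}).

(** The divisibilities that make u^-a1 v^-a2 F(u^b, v^c) a Laurent polynomial in
    {u, v} and in the two clusters obtained from it by one exchange.  Unlike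
    [row_factor] they impose no degree bounds and are multiplicative. *)
Definition divisible_at a F : Prop :=
  (forall q : nat, div_pow1X (pos_part (a.2 - (c * q)%:Z)) F`_q) /\
  (forall p : nat, div_pow1X (pos_part (a.1 - (b * p)%:Z)) (swapXY F)`_p).


Lemma divisible_atD a F G : divisible_at a F -> divisible_at a G -> divisible_at a (F + G).
Proof.
move=> [hF kF] [hG kG]; split=> i; rewrite ?raddfD /= coefD; exact: div_pow1X_add.
Qed.

Lemma divisible_atN a F : divisible_at a F -> divisible_at a (- F).
Proof. by move=> [hF kF]; split=> i; rewrite ?raddfN /= coefN; apply: div_pow1X_opp. Qed.

Lemma divisible_at0 a : divisible_at a 0.
Proof. by split=> i; rewrite ?raddf0 coef0; apply: div_pow1X_0. Qed.

Lemma divisible_at_sum a (I : Type) (s : seq I) (P : pred I) f :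
  (forall i, P i -> divisible_at a (f i)) -> divisible_at a (\sum_(i <- s | P i) f i).
Proof.
by move=> h; apply: big_ind => //; [apply: divisible_at0 | apply: divisible_atD].
Qed.

Lemma divisible_atM a a' F G : divisible_at a F -> divisible_at a' G ->
  divisible_at (a.1 + a'.1, a.2 + a'.2) (F * G).
Proof.
have le (x y : int) k i j : (k * (i + j))%N = (k * i + k * j)%N ->
    (pos_part (x + y - (k * (i + j))%:Z) <= pos_part (x - (k * i)%:Z) + pos_part (y - (k * j)%:Z))%N.
  move=> e; have := pos_partE (x + y - (k * (i + j))%:Z).
  have := pos_partE (x - (k * i)%:Z); have := pos_partE (y - (k * j)%:Z); lia.
move=> [hF kF] [hG kG]; split=> i; rewrite ?rmorphM /= coefM; apply: div_pow1X_sum => j _.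
  apply: div_pow1X_mul (hF j) (hG (i - j)%N).
  have := le a.2 a'.2 c j (i - j)%N (mulnDr _ _ _).
  by rewrite subnKC // -ltnS.
apply: div_pow1X_mul (kF j) (kG (i - j)%N).
have := le a.1 a'.1 b j (i - j)%N (mulnDr _ _ _).
by rewrite subnKC // -ltnS.
Qed.

Lemma divisible_at_shift a F p q : divisible_at (a.1 - (b * p)%:Z, a.2 - (c * q)%:Z) F ->
  divisible_at a ('X^q * ('X^p)%:P * F).
Proof.
move=> [hF kF]; split=> i.
  rewrite -mulrA coefXnM coefCM; case: ltnP => iq; first exact: div_pow1X_0.
  have := hF (i - q)%N => /=.
  rewrite -addrA -opprD -PoszD -mulnDr subnKC // => -[e ->].
  by exists ('X^p * e); rewrite mulrCA.
rewrite !rmorphM /= !swapXY_polyC map_polyXn rmorphXn /= swapXY_X mulrAC [_ * 'X^p]mulrC.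
rewrite coefXnM; case: ltnP => ip; first exact: div_pow1X_0.
rewrite -rmorphXn /= coefCM; have := kF (i - p)%N => /=.
rewrite -addrA -opprD -PoszD -mulnDr subnKC // => -[e ->].
by exists ('X^q * e); rewrite mulrCA.
Qed.

Lemma divisible_atZ a (z : int) F : divisible_at a F -> divisible_at a (z%:P%:P * F).
Proof.
move=> [hF kF]; split=> i; rewrite ?rmorphM /= ?swapXY_polyC ?map_polyC /= coefCM.
  by have [e ->] := hF i; exists (z%:P * e); rewrite mulrCA.
by have [e ->] := kF i; exists (z%:P * e); rewrite mulrCA.
Qed.

Section Span.

Variables (K : fieldType) (u v : K).
Hypotheses (u_neq0 : u != 0) (v_neq0 : v != 0).

Lemma laurent_at_shift a F p q : laurent_at b c a ('X^q * ('X^p)%:P * F) u v =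
  laurent_at b c (a.1 - (b * p)%:Z, a.2 - (c * q)%:Z) F u v.
Proof.
rewrite /laurent_at /= !rmorphM !rmorphXn /= ev2X ev2C ?rmorphXn /= ev1X -!exprM.
rewrite !opprB ![_ - _.1]addrC ![_ - _.2]addrC !expfzDr //.
rewrite -!exprnP; ring.
Qed.

Lemma laurent_atD a F G : laurent_at b c a (F + G) u v =
  laurent_at b c a F u v + laurent_at b c a G u v.
Proof. by rewrite /laurent_at rmorphD mulrDr. Qed.

Lemma laurent_at_sum a (I : Type) (s : seq I) (P : pred I) f :
  laurent_at b c a (\sum_(i <- s | P i) f i) u v =
  \sum_(i <- s | P i) laurent_at b c a (f i) u v.
Proof. by rewrite /laurent_at rmorph_sum mulr_sumr. Qed.

Lemma laurent_atZ a (z : int) F : laurent_at b c a (z%:P%:P * F) u v =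
  z%:~R * laurent_at b c a F u v.
Proof.
rewrite /laurent_at rmorphM /= ev2C /ev1 /= map_polyC /horner_eval hornerC /=.
by rewrite mulrCA.
Qed.

Lemma laurent_atM a a' F G :
  laurent_at b c a F u v * laurent_at b c a' G u v =
  laurent_at b c (a.1 + a'.1, a.2 + a'.2) (F * G) u v.
Proof. by rewrite /laurent_at rmorphM /= !opprD !expfzDr //; ring. Qed.

Variables (P : K -> Prop) (Y : int * int -> {poly {poly int}}).
Hypotheses (P0 : P 0) (PD : forall x y, P x -> P y -> P (x + y)).
Hypothesis PZ : forall (z : int) x, P x -> P (z%:~R * x).
Hypothesis PY : forall a, P (laurent_at b c a (Y a) u v).
Hypothesis Y_div : forall a, divisible_at a (Y a).
Hypothesis Y_col0 : forall a, (swapXY (Y a))`_0 = (1 + 'X) ^+ pos_part a.1.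
Hypothesis Y_neg : forall a, a.1 <= 0 -> Y a = ((1 + 'X) ^+ pos_part a.2)%:P.

Lemma span_sum (I : Type) (s : seq I) (Q : pred I) f :
  (forall i, Q i -> P (f i)) -> P (\sum_(i <- s | Q i) f i).
Proof. by move=> h; apply: big_ind. Qed.

Lemma div_pow1X_X n (D : {poly int}) : div_pow1X n ('X * D) -> div_pow1X n D.
Proof.
case=> f e; have f0 : f`_0 = 0 by rewrite -(coef0_pow1X_mul n) -e coefXM.
have [g fg] : exists g, f = 'X * g.
  exists (\poly_(i < (size f).-1) f`_i.+1); apply/polyP => i; rewrite coefXM coef_poly.
  case: i => [//|i] /=; case: ltnP => // h; rewrite nth_default //; lia.
exists g; apply: (mulfI (_ : 'X != 0 :> {poly int})); first by rewrite polyX_eq0.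
by rewrite e fg mulrCA.
Qed.

Lemma span_divisible_neg a F : a.1 <= 0 -> divisible_at a F -> P (laurent_at b c a F u v).
Proof.
move=> aneg [rowF _]; rewrite -[F]coefK poly_def laurent_at_sum.
apply: span_sum => q _; have [D ->] := rowF q; set n := pos_part _.
have -> : ((1 + 'X) ^+ n * D) *: 'X^q =
    \sum_(p < size D) (D`_p)%:P%:P * ('X^q * ('X^p)%:P * ((1 + 'X) ^+ n)%:P) :> {poly {poly int}}.
  transitivity (('X^q * ((1 + 'X) ^+ n)%:P) * D%:P : {poly {poly int}}).
    by rewrite -mul_polyC polyCM; ring.
  rewrite -{1}[D]coefK poly_def raddf_sum mulr_sumr; apply: eq_bigr => p _ /=.
  by rewrite -mul_polyC polyCM; ring.
rewrite laurent_at_sum; apply: span_sum => p _; rewrite laurent_atZ; apply: PZ.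
rewrite laurent_at_shift; have -> : ((1 + 'X) ^+ n)%:P = Y (a.1 - (b * p)%:Z, a.2 - (c * q)%:Z).
  by rewrite Y_neg //=; lia.
exact: PY.
Qed.

(** If a1 <= 0 every row is a combination of members of the family.  If a1 > 0 the
    first column is (1 + s)^a1 e(s); subtracting the members of the family
    pointed at (a1, a2 - cq), with the coefficients of e, removes this column
    and what is left is pointed at (a1 - b, a2). *)
Lemma span_divisible a F : divisible_at a F -> P (laurent_at b c a F u v).
Proof.
case: a => a1 a2; have [N] : exists N : nat, a1 <= N%:Z by exists `|a1|%N; lia.
elim: N a1 F => [|N IH] a1 F a1N dF; first exact: span_divisible_neg.
have [aneg|apos] := lerP a1 0; first exact: span_divisible_neg.
have [e eE] := dF.2 0%N; rewrite /= muln0 subr0 in eE.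
pose y q := 'X^q * ('X^0)%:P * Y (a1 - (b * 0)%:Z, a2 - (c * q)%:Z).
pose S := \sum_(q < size e) (e`_q)%:P%:P * y q.
have dS : divisible_at (a1, a2) S.
  by apply: divisible_at_sum => q _; apply: divisible_atZ; apply: divisible_at_shift.
have PS : P (laurent_at b c (a1, a2) S u v).
  rewrite laurent_at_sum; apply: span_sum => q _; rewrite laurent_atZ; apply: PZ.
  by rewrite laurent_at_shift; apply: PY.
have e0 : a1 - (b * 0)%:Z = a1 by lia.
have S0 : (swapXY S)`_0 = (swapXY F)`_0.
  rewrite eE -{1}[e]coefK poly_def mulr_sumr raddf_sum coef_sum; apply: eq_bigr => q _ /=.
  rewrite /y expr0 polyC1 mulr1 !rmorphM /= swapXY_polyC map_polyC /= coefCM.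
  rewrite rmorphXn /= swapXY_X -rmorphXn /= coefCM Y_col0 /= e0.
  by rewrite -mul_polyC; ring.
pose H := \poly_(i < (size (swapXY (F - S))).-1) (swapXY (F - S))`_i.+1.
have XH : swapXY (F - S) = 'X * H.
  apply/polyP => i; rewrite coefXM coef_poly; case: i => [|i] /=.
    by rewrite raddfB coefB S0 subrr.
  by case: ltnP => // h; rewrite nth_default //; lia.
have FS : F - S = 'X^0 * ('X^1)%:P * swapXY H.
  by rewrite -[LHS]swapXYK XH rmorphM /= swapXY_X expr0 mul1r expr1.
have dFS : divisible_at (a1, a2) (F - S) by apply/divisible_atD/divisible_atN.
have dH : divisible_at (a1 - (b * 1)%:Z, a2 - (c * 0)%:Z) (swapXY H).
  split=> i /=.
    rewrite muln0 subr0; have := dFS.1 i; rewrite FS expr0 mul1r expr1 coefCM.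
    exact: div_pow1X_X.
  have := dFS.2 i.+1; rewrite XH swapXYK coefXM /= => h.
  by rewrite -addrA -opprD -PoszD -mulnDr add1n.
rewrite -[F](subrK S) laurent_atD; apply: PD => //.
have e2 : a2 - (c * 0)%:Z = a2 by lia.
rewrite FS laurent_at_shift /=; rewrite /= e2 in dH *; apply: IH => //; lia.
Qed.

End Span.
End UpperBound.

Section Membership.

Variables b c : nat.
Hypotheses (b_gt0 : (0 < b)%N) (c_gt0 : (0 < c)%N).

Local Notation A := (cluster_algebra b c).

Lemma ca_zero : A 0.
Proof. by rewrite -(subrr 1); apply: ca_sub; apply: ca_one. Qed.

Lemma ca_opp f : A f -> A (- f).
Proof. by move=> h; rewrite -sub0r; apply: ca_sub => //; apply: ca_zero. Qed.

Lemma ca_add f g : A f -> A g -> A (f + g).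
Proof. by move=> hf hg; rewrite -[g]opprK; apply: ca_sub => //; apply: ca_opp. Qed.

Lemma ca_exp f n : A f -> A (f ^+ n).
Proof.
move=> hf; elim: n => [|n IH]; first exact: ca_one.
by rewrite exprS; apply: ca_mul.
Qed.

Lemma ca_int (z : int) : A z%:~R.
Proof.
have nat_ca (n : nat) : A n%:R.
  elim: n => [|n IH]; first exact: ca_zero.
  by rewrite -addn1 natrD; apply: ca_add => //; apply: ca_one.
case: z => n; first exact: nat_ca.
by rewrite NegzE rmorphN /=; apply: ca_opp; apply: nat_ca.
Qed.

(** At (a1, a2) this gives the product of a power of x3 or x1 with a power of x0 or
    x2, which lies in the cluster algebra by construction. *)
Definition standard_poly (a : int * int) : {poly {poly int}} :=
  ((1 + 'X) ^+ pos_part a.2)%:P * (1 + 'X) ^+ pos_part a.1.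

Lemma swapXY_standard a1 a2 : swapXY (standard_poly (a1, a2)) = standard_poly (a2, a1).
Proof.
rewrite /standard_poly rmorphM /= swapXY_polyC !rmorphXn !rmorphD !rmorph1 /=.
by rewrite map_polyX swapXY_X mulrC.
Qed.

Lemma coef_standard a q :
  (standard_poly a)`_q = (1 + 'X) ^+ pos_part a.2 * ('C(pos_part a.1, q)%:Z)%:P.
Proof.
rewrite coefCM; congr (_ * _).
have -> : (1 + 'X : {poly {poly int}}) = map_poly polyC (1 + 'X).
  by rewrite rmorphD rmorph1 /= map_polyX.
by rewrite -rmorphXn coef_map coef_pow1X.
Qed.

Lemma standard_row (k : nat) a q :
  div_pow1X (pos_part (a.2 - (k * q)%:Z)) (standard_poly a)`_q.
Proof.
rewrite coef_standard.
have le : (pos_part (a.2 - (k * q)%:Z) <= pos_part a.2)%N.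
  by have := pos_partE (a.2 - (k * q)%:Z); have := pos_partE a.2; lia.
exists ((1 + 'X) ^+ (pos_part a.2 - pos_part (a.2 - (k * q)%:Z)) * ('C(pos_part a.1, q)%:Z)%:P).
by rewrite mulrA -exprD subnKC.
Qed.

Lemma standard_divisible a : divisible_at b c a (standard_poly a).
Proof.
split=> i; first exact: standard_row.
by case: a => a1 a2; rewrite swapXY_standard; apply: (standard_row b (a2, a1)).
Qed.

Lemma standard_col0 a : (swapXY (standard_poly a))`_0 = (1 + 'X) ^+ pos_part a.1.
Proof.
by case: a => a1 a2; rewrite swapXY_standard coef_standard bin0 polyC1 mulr1.
Qed.

(** In the application y is the neighbour of x, and x y is the right-hand side of
    the exchange relation. *)
Lemma exchange_factor (K : fieldType) (x y : K) (s : int) : x != 0 ->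
  x ^ (- s) * (x * y) ^+ pos_part s = if s is Posz n then y ^+ n else x ^+ pos_part (- s).
Proof.
case: s => n x0 /=; last by rewrite mulr1 NegzE opprK.
rewrite exprMn mulrA -exprz_inv -!exprnP exprVn mulVf ?mul1r //.
by rewrite expf_neq0.
Qed.

Lemma standard_ca a :
  A (laurent_at b c a (standard_poly a) (cluster_var b c 1) (cluster_var b c 2)).
Proof.
rewrite /laurent_at /standard_poly rmorphM /= ev2C !rmorphXn !rmorphD !rmorph1 /= ev1X ev2X.
set x1 := cluster_var b c 1; set x2 := cluster_var b c 2.
have e1 : 1 + x1 ^+ b = x2 * cluster_var b c 0.
  by rewrite addrC mulrC -(exchange_relation b c 1).
have e2 : 1 + x2 ^+ c = x1 * cluster_var b c 3.
  by rewrite addrC -(exchange_relation b c 2).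
have -> : x1 ^ (- a.1) * x2 ^ (- a.2) * ((1 + x1 ^+ b) ^+ pos_part a.2 * (1 + x2 ^+ c) ^+ pos_part a.1)
  = (x1 ^ (- a.1) * (1 + x2 ^+ c) ^+ pos_part a.1) * (x2 ^ (- a.2) * (1 + x1 ^+ b) ^+ pos_part a.2).
  by ring.
rewrite e1 e2 !exchange_factor ?cluster_var_neq0 //.
by apply: ca_mul; [case: a.1 | case: a.2] => n; apply: ca_exp; apply: ca_var.
Qed.

Lemma greedy_poly_divisible a :
  divisible_at b c a (greedy_poly b c (pos_part a.1) (pos_part a.2)).
Proof.
split=> i.
  have [_ -> _] := greedy_row b (pos_part a.1) (pos_part a.2) c_gt0.
  by rewrite pos_part_subn; exists (greedy_quot b c (pos_part a.1) (pos_part a.2) i).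
have [_ -> _] := greedy_col c (pos_part a.1) (pos_part a.2) b_gt0.
by rewrite pos_part_subn; exists (greedy_quot c b (pos_part a.2) (pos_part a.1) i).
Qed.

Lemma greedy_poly_col0 a1 a2 : (swapXY (greedy_poly b c a1 a2))`_0 = (1 + 'X) ^+ a1.
Proof.
by have [d0 -> _] := greedy_col c a1 a2 b_gt0; rewrite d0 muln0 subn0 mulr1.
Qed.

Lemma greedy_poly0 a2 : greedy_poly b c 0 a2 = ((1 + 'X) ^+ a2)%:P.
Proof.
apply/polyP => q; rewrite coefC; case: q => [|q].
  by have [d0 -> _] := greedy_row b 0 a2 c_gt0; rewrite d0 muln0 subn0 mulr1.
by rewrite nth_default // (leq_trans (size_greedy_poly _ _ _ c_gt0)).
Qed.

Lemma standard_poly0 a : a.1 <= 0 -> standard_poly a = ((1 + 'X) ^+ pos_part a.2)%:P.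
Proof.
move=> h; rewrite /standard_poly; have -> : pos_part a.1 = 0%N by have := pos_partE a.1; lia.
by rewrite mulr1.
Qed.

Lemma laurent_divisible_ca a F : divisible_at b c a F ->
  A (laurent_at b c a F (cluster_var b c 1) (cluster_var b c 2)).
Proof.
apply: (@span_divisible b c b_gt0 c_gt0 _ _ _ (cluster_var_neq0 b c 1)
  (cluster_var_neq0 b c 2) A standard_poly).
- exact: ca_zero.
- exact: ca_add.
- by move=> z x; apply: ca_mul; apply: ca_int.
- exact: standard_ca.
- exact: standard_divisible.
- exact: standard_col0.
- exact: standard_poly0.
Qed.

Lemma greedy_in_ca m a : A (greedy_in b c m a).
Proof.
have [a' ->] := greedy_in_any b_gt0 c_gt0 m 1 a.
exact/laurent_divisible_ca/greedy_poly_divisible.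
Qed.

Lemma greedy_in_monomial m (d1 d2 : nat) :
  greedy_in b c m (- d1%:Z, - d2%:Z) = odd_var b c m ^+ d1 * even_var b c m ^+ d2.
Proof.
have p0 (d : nat) : pos_part (- d%:Z) = 0%N by case: d.
rewrite /greedy_in /greedy_elt /laurent_at /= !p0 greedy_poly0 expr0 polyC1 rmorph1.
by rewrite mulr1 !opprK.
Qed.

Lemma cluster_monomial_greedy m (d1 d2 : nat) :
  exists a, cluster_var b c m ^+ d1 * cluster_var b c (m + 1) ^+ d2 = greedy_in b c m a.
Proof.
have := greedy_in_monomial m; rewrite /odd_var /even_var; case: odd_int => h.
  by exists (- d1%:Z, - d2%:Z); rewrite h.
by exists (- d2%:Z, - d1%:Z); rewrite h mulrC.
Qed.

Definition greedy_span (f : ratfun) : Prop := exists s : seq (int * (int * int)),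
  f = \sum_(x <- s) x.1%:~R * greedy_in b c 1 x.2.

Lemma greedy_span0 : greedy_span 0.
Proof. by exists [::]; rewrite big_nil. Qed.

Lemma greedy_spanD f g : greedy_span f -> greedy_span g -> greedy_span (f + g).
Proof. by case=> s -> [t ->]; exists (s ++ t); rewrite big_cat. Qed.

Lemma greedy_spanZ (z : int) f : greedy_span f -> greedy_span (z%:~R * f).
Proof.
case=> s ->; exists [seq (z * x.1, x.2) | x <- s]; rewrite big_map mulr_sumr.
by apply: eq_bigr => x _; rewrite intrM mulrA.
Qed.

Lemma greedy_span_greedy m a : greedy_span (greedy_in b c m a).
Proof.
have [a' ->] := greedy_in_any b_gt0 c_gt0 m 1 a.
by exists [:: (1, a')]; rewrite big_seq1 mul1r.
Qed.

Lemma laurent_divisible_span a F : divisible_at b c a F ->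
  greedy_span (laurent_at b c a F (cluster_var b c 1) (cluster_var b c 2)).
Proof.
apply: (@span_divisible b c b_gt0 c_gt0 _ _ _ (cluster_var_neq0 b c 1)
  (cluster_var_neq0 b c 2) greedy_span
  (fun a => greedy_poly b c (pos_part a.1) (pos_part a.2))).
- exact: greedy_span0.
- exact: greedy_spanD.
- exact: greedy_spanZ.
- by move=> a'; apply: (greedy_span_greedy 1).
- exact: greedy_poly_divisible.
- by move=> a'; rewrite greedy_poly_col0.
- move=> a' h; rewrite -greedy_poly0; congr greedy_poly.
  by have := pos_partE a'.1; lia.
Qed.

Lemma greedy_spanM f g : greedy_span f -> greedy_span g -> greedy_span (f * g).
Proof.
case=> s -> [t ->]; rewrite mulr_suml.
apply: (big_ind greedy_span greedy_span0 greedy_spanD) => x _; rewrite mulr_sumr.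
apply: (big_ind greedy_span greedy_span0 greedy_spanD) => y _; rewrite mulrACA.
rewrite -intrM; apply: greedy_spanZ; rewrite /greedy_in /greedy_elt.
rewrite laurent_atM ?cluster_var_neq0 //; apply: laurent_divisible_span.
by apply: (@divisible_atM _ _ b_gt0 c_gt0 x.2 y.2); apply: greedy_poly_divisible.
Qed.

(** The cluster variables are greedy, and the span is closed under products because
    divisibility is multiplicative. *)
Lemma ca_greedy_span f : A f -> greedy_span f.
Proof.
elim=> {f} [m||f g _ hf _ hg|f g _ hf _ hg].
- have [a] := cluster_monomial_greedy m 1 0.
  by rewrite expr1 expr0 mulr1 => ->; apply: greedy_span_greedy.
- have [a] := cluster_monomial_greedy 1 0 0.
  by rewrite !expr0 mulr1 => ->; apply: greedy_span_greedy.
- by apply: greedy_spanD => //; rewrite -mulN1r -[-1]/((-1)%:~R); apply: greedy_spanZ.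
- exact: greedy_spanM.
Qed.

End Membership.

(** * Uniqueness of Laurent expansions *)

Section LaurentUniqueness.

Local Notation x1 := initial_x1.
Local Notation x2 := initial_x2.

Let mon (p q : nat) : 'X_{1..2} := (U_(ord0) *+ p + U_(ord_max) *+ q)%MM.

Lemma mon_inj p q p' q' : (mon p q == mon p' q') = (p == p') && (q == q').
Proof.
apply/eqP/andP => [e|[/eqP-> /eqP->] //].
have := congr1 (fun m : 'X_{1..2} => m ord0) e.
have := congr1 (fun m : 'X_{1..2} => m ord_max) e.
by rewrite /mon !mnmDE !mulmnE !mnm1E /= !mul0n !mul1n !add0n !addn0 => -> ->.
Qed.

Lemma ev1_initial (P : {poly int}) q :
  ev1 x1 P * x2 ^+ q = tofrac (\sum_(p < size P) ('X_[mon p q] *~ P`_p : {mpoly rat[2]})).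
Proof.
rewrite -{1}[P]coefK poly_def raddf_sum mulr_suml rmorph_sum; apply: eq_bigr => p _ /=.
rewrite -mul_polyC rmorphM rmorphXn /= ev1X [ev1 _ _%:P]/ev1 /= map_polyC /horner_eval hornerC /=.
rewrite raddfMz /= /mon mpolyXD -!mpolyXn tofracM !tofracXn -/x1 -/x2.
by rewrite -mulrA mulrzl.
Qed.

Lemma ev2_initial_inj F : ev2 x1 x2 F = 0 -> F = 0.
Proof.
rewrite (ev2_sum _ _ (leqnn _)); under eq_bigr => q _ do rewrite ev1_initial.
rewrite -rmorph_sum /= => /eqP; rewrite tofrac_eq0 => /eqP e.
apply/polyP => q; apply/polyP => p; rewrite !coef0.
have := congr1 (mcoeff (mon p q)) e; rewrite raddf_sum mcoeff0 /=.
under eq_bigr => i _.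
  rewrite raddf_sum /=; under eq_bigr => j _ do rewrite raddfMz /= mcoeffX mon_inj.
  over.
have [qF|Fq] := ltnP q (size F); last by rewrite (nth_default _ Fq) coef0.
have [pF|Fp] := ltnP p (size F`_q); last by rewrite (nth_default _ Fp).
rewrite (bigD1 (Ordinal qF)) //= [X in _ + X]big1 => [|i ne]; last first.
  rewrite big1 // => j _; have -> : (i == q :> nat) = false by apply/negbTE.
  by rewrite andbF mul0rz.
rewrite (bigD1 (Ordinal pF)) //= [X in _ + X + _]big1 => [|j ne]; last first.
  have -> : (j == p :> nat) = false by apply/negbTE.
  by rewrite mul0rz.
by rewrite !eqxx !addr0 => /eqP; rewrite intr_eq0 => /eqP.
Qed.

End LaurentUniqueness.

Section MonomialSums.

Lemma sum_seq_pred1 (V : zmodType) (T : eqType) (D : seq T) (d : T) (f : T -> V) :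
  uniq D -> \sum_(j <- D | j == d) f j = if d \in D then f d else 0.
Proof.
move=> uD; case: ifP => dD.
  rewrite big_mkcond (bigD1_seq d) //= eqxx big1 ?addr0 // => i /negbTE -> //.
rewrite big_seq_cond big1 // => i /andP[iD /eqP e].
by rewrite -e iD in dD.
Qed.

(** A Laurent polynomial is handled as a list of terms (coefficient, exponents), with
    repetitions allowed; the coefficients are recovered by collecting like terms. *)
Definition mono_coef (s : seq (int * (int * int))) (d : int * int) : int :=
  \sum_(x <- s | x.2 == d) x.1.

Definition mono_sum (K : fieldType) (s : seq (int * (int * int))) (u v : K) : K :=
  \sum_(x <- s) x.1%:~R * u ^ x.2.1 * v ^ x.2.2.

Definition mono_bound (s : seq (int * (int * int))) : nat :=
  \sum_(x <- s) (`|x.2.1| + `|x.2.2|)%N.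

Lemma mono_boundP s x : x \in s -> (`|x.2.1| + `|x.2.2| <= mono_bound s)%N.
Proof. by move=> xs; rewrite /mono_bound (big_rem x) //= leq_addr. Qed.

(** The Laurent polynomial multiplied by u^N v^N, which clears the denominators as
    soon as N is at least [mono_bound]. *)
Definition mono_poly (N : nat) (s : seq (int * (int * int))) : {poly {poly int}} :=
  \sum_(x <- s) x.1%:P%:P * ('X^`|N%:Z + x.2.2| * ('X^`|N%:Z + x.2.1|)%:P).

Lemma coef_mono_poly N s j i : (mono_bound s <= N)%N ->
  (mono_poly N s)`_j`_i = mono_coef s (i%:Z - N%:Z, j%:Z - N%:Z).
Proof.
move=> le; rewrite /mono_poly /mono_coef !coef_sum [RHS]big_mkcond /=.
rewrite big_seq_cond [RHS]big_seq_cond; apply: eq_bigr => x; rewrite andbT => /mono_boundP h.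
case: x h => z [d1 d2] /= h; rewrite coefCM coefMC coefXn coefCM xpair_eqE.
have -> : (d1 == i%:Z - N%:Z) = (i == absz (N%:Z + d1)) by lia.
have -> : (d2 == j%:Z - N%:Z) = (j == absz (N%:Z + d2)) by lia.
case: (j == _); last by rewrite mul0r coef0 mulr0 andbF.
by rewrite mul1r coefXn andbT; case: (i == _); rewrite ?mulr1 ?mulr0.
Qed.

Lemma exprz_shift (K : fieldType) (u : K) (N : nat) (d : int) : u != 0 ->
  (`|d| <= N)%N -> u ^+ `|N%:Z + d| = u ^+ N * u ^ d.
Proof. by move=> u0 le; rewrite !exprnP -expfzDr //; congr (_ ^ _); lia. Qed.

Lemma ev2_mono_poly (K : fieldType) (u v : K) N s : u != 0 -> v != 0 ->
  (mono_bound s <= N)%N -> ev2 u v (mono_poly N s) = u ^+ N * v ^+ N * mono_sum s u v.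
Proof.
move=> u0 v0 le; rewrite raddf_sum mulr_sumr big_seq_cond [RHS]big_seq_cond /=.
apply: eq_bigr => x; rewrite andbT => /mono_boundP h.
rewrite !rmorphM rmorphXn /= ev2X !ev2C [ev1 _ _%:P]/ev1 /= map_polyC /horner_eval hornerC /=.
rewrite rmorphXn /= ev1X.
have hu : (`|x.2.1| <= N)%N by apply: leq_trans (leq_trans (leq_addr _ _) h) le.
have hv : (`|x.2.2| <= N)%N by apply: leq_trans (leq_trans (leq_addl _ _) h) le.
rewrite !exprz_shift //.
by ring.
Qed.

(** Algebraic independence of u and v over the integers. *)
Definition ev_injective (K : fieldType) (u v : K) := forall F, ev2 u v F = 0 -> F = 0.

Lemma mono_sum_inj (K : fieldType) (u v : K) s t : ev_injective u v ->
  u != 0 -> v != 0 -> mono_sum s u v = mono_sum t u v -> mono_coef s =1 mono_coef t.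
Proof.
move=> inj u0 v0 e [d1 d2].
pose N := (mono_bound s + mono_bound t + `|d1| + `|d2|)%N.
have sN : (mono_bound s <= N)%N by rewrite /N; lia.
have tN : (mono_bound t <= N)%N by rewrite /N; lia.
have /inj/eqP : ev2 u v (mono_poly N s - mono_poly N t) = 0.
  by rewrite rmorphB /= !ev2_mono_poly // e subrr.
rewrite subr_eq0 => /eqP/(congr1 (fun F : {poly {poly int}} => F`_(absz (N%:Z + d2))`_(absz (N%:Z + d1)))).
rewrite !coef_mono_poly //.
have -> : `|N%:Z + d1|%:Z - N%:Z = d1 by rewrite /N; lia.
by have -> : `|N%:Z + d2|%:Z - N%:Z = d2 by rewrite /N; lia.
Qed.

Lemma mono_coef_cat s t d : mono_coef (s ++ t) d = mono_coef s d + mono_coef t d.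
Proof. by rewrite /mono_coef big_cat. Qed.

Lemma mono_sum_cat (K : fieldType) (u v : K) s t :
  mono_sum (s ++ t) u v = mono_sum s u v + mono_sum t u v.
Proof. by rewrite /mono_sum big_cat. Qed.

Definition mono_swap (s : seq (int * (int * int))) :=
  [seq (x.1, (x.2.2, x.2.1)) | x <- s].

Lemma mono_sum_swap (K : fieldType) (u v : K) s :
  mono_sum (mono_swap s) u v = mono_sum s v u.
Proof.
rewrite /mono_sum big_map; apply: eq_bigr => x _ /=.
by rewrite mulrAC.
Qed.

Lemma mono_coef_swap s i j : mono_coef (mono_swap s) (i, j) = mono_coef s (j, i).
Proof.
rewrite /mono_coef big_map; apply: eq_bigl => -[z [d1 d2]] /=.
by rewrite !xpair_eqE andbC.
Qed.

Definition mono_of (L : {fsfun int * int -> int with 0}) : seq (int * (int * int)) :=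
  [seq (L d, d) | d <- finsupp L].

Lemma mono_sum_of L (u v : ratfun) : mono_sum (mono_of L) u v = laurent_eval L u v.
Proof. by rewrite /mono_sum big_map. Qed.

Lemma mono_coef_of L d : mono_coef (mono_of L) d = L d.
Proof.
rewrite /mono_coef big_map /= (sum_seq_pred1 d (fun d => L d) (fset_uniq _)).
by case: ifP => // /negbT /fsfun_dflt.
Qed.

Lemma sum_finsupp (K : choiceType) (R : zmodType) (n : {fsfun K -> int with 0})
    (D : seq K) (f : K -> R) : uniq D -> {subset finsupp n <= D} ->
  \sum_(d <- finsupp n) f d *~ n d = \sum_(d <- D) f d *~ n d.
Proof.
move=> uD sub; rewrite [RHS](bigID (fun d => d \in finsupp n)) /= [X in _ + X]big1; last first.
  by move=> d /fsfun_dflt ->; rewrite mulr0z.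
rewrite addr0 -[RHS]big_filter.
rewrite (perm_big [seq d <- D | d \in finsupp n]) //; apply: uniq_perm.
- exact: fset_uniq.
- exact: filter_uniq.
by move=> d; rewrite mem_filter; case: (boolP (d \in finsupp n)) => [/sub ->|].
Qed.

Lemma mono_regroup (V : zmodType) (s : seq (int * (int * int))) (f : int * int -> V) :
  \sum_(x <- s) f x.2 *~ x.1 = \sum_(d <- undup (map snd s)) f d *~ mono_coef s d.
Proof.
under [RHS]eq_bigr => d _ do rewrite /mono_coef mulrz_sumr big_mkcond /=.
rewrite exchange_big /= big_seq_cond [RHS]big_seq_cond; apply: eq_bigr => x /andP[xs _].
rewrite -big_mkcond /=; under eq_bigl => d do rewrite eq_sym.
rewrite (sum_seq_pred1 _ (fun d => f d *~ x.1) (undup_uniq _)).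
by rewrite mem_undup map_f.
Qed.

Definition fsfun_of_mono (s : seq (int * (int * int))) : {fsfun int * int -> int with 0} :=
  [fsfun d in [fset d in map snd s]%fset => mono_coef s d | 0].

Lemma fsfun_of_monoE s d : fsfun_of_mono s d = mono_coef s d.
Proof.
rewrite fsfunE inE /=; case: ifP => // /negbT ns.
rewrite /mono_coef big_seq_cond big1 // => x /andP[xs /eqP e].
by case/negP: ns; rewrite -e map_f.
Qed.

Lemma finsupp_fsfun_of_mono s : {subset finsupp (fsfun_of_mono s) <= undup (map snd s)}.
Proof.
move=> d; rewrite mem_finsupp fsfunE inE mem_undup; case: ifP => //.
Qed.

Lemma laurent_eval_fsfun_of_mono s u v :
  laurent_eval (fsfun_of_mono s) u v = mono_sum s u v.
Proof.
pose f (d : int * int) : ratfun := u ^ d.1 * v ^ d.2.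
transitivity (\sum_(d <- finsupp (fsfun_of_mono s)) f d *~ fsfun_of_mono s d).
  by apply: eq_bigr => d _; rewrite -[RHS]mulrzl /f mulrA.
rewrite (sum_finsupp f (undup_uniq _) (@finsupp_fsfun_of_mono s)).
under eq_bigr => d _ do rewrite fsfun_of_monoE.
rewrite -mono_regroup; apply: eq_bigr => x _.
by rewrite -[LHS]mulrzl /f mulrA.
Qed.

End MonomialSums.

(** * Greedy elements as Laurent polynomials *)

Section LaurentExpansion.

Variables b c : nat.
Hypotheses (b_gt0 : (0 < b)%N) (c_gt0 : (0 < c)%N).
Implicit Types (a : int * int) (F : {poly {poly int}}).

Lemma ev1_sum (K : fieldType) (u : K) (P : {poly int}) N : (size P <= N)%N ->
  ev1 u P = \sum_(p < N) (P`_p)%:~R * u ^+ p.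
Proof.
move=> le; rewrite /ev1 /= /horner_eval (horner_coef_wide _ (n := N)).
  by apply: eq_bigr => p _; rewrite coef_map.
by rewrite (leq_trans (size_poly _ _)).
Qed.

Definition support_grid F : seq (nat * nat) :=
  [seq (p, q) | q <- iota 0 (size F), p <- iota 0 (size (swapXY F))].

Lemma support_grid_uniq F : uniq (support_grid F).
Proof.
by apply: allpairs_uniq; rewrite ?iota_uniq // => -[q p] [q' p'] _ _ [-> ->].
Qed.

Lemma mem_support_grid F p q : F`_q`_p != 0 -> (p, q) \in support_grid F.
Proof.
move=> nz; apply/allpairsP; exists (q, p); split=> //=; rewrite mem_iota /= add0n ltnNge.
  by apply: contra nz => h; rewrite (nth_default 0 h) coef0.
by apply: contra nz => h; rewrite -coef_swapXY (nth_default 0 h) coef0.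
Qed.

Lemma ev2_grid (K : fieldType) (u v : K) F :
  ev2 u v F = \sum_(d <- support_grid F) (u ^+ d.1 * v ^+ d.2) *~ F`_d.2`_d.1.
Proof.
rewrite (ev2_sum _ _ (leqnn _)) big_allpairs_dep /= -[X in iota 0 X]subn0.
rewrite -/(index_iota _ _) big_mkord; apply: eq_bigr => q _.
rewrite -[X in iota 0 X]subn0 -/(index_iota _ _) big_mkord.
have le : (size (F`_q)%R <= size (swapXY F))%N by rewrite -sizeYE max_size_coefXY.
rewrite (ev1_sum _ le) mulr_suml; apply: eq_bigr => p _.
by rewrite -mulrA mulrzl.
Qed.

Definition laurent_mono a F : seq (int * (int * int)) :=
  [seq (F`_d.2`_d.1, (- a.1 + (b * d.1)%:Z, - a.2 + (c * d.2)%:Z)) | d <- support_grid F].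

Lemma mono_sum_laurent (K : fieldType) (u v : K) a F : u != 0 -> v != 0 ->
  mono_sum (laurent_mono a F) u v = laurent_at b c a F u v.
Proof.
move=> u0 v0; rewrite /mono_sum big_map /laurent_at ev2_grid mulr_sumr.
apply: eq_bigr => d _ /=; rewrite !expfzDr // -[_ *~ _]mulrzl -!exprM -!exprnP.
by ring.
Qed.

Lemma mono_coef_laurent a F p q :
  mono_coef (laurent_mono a F) (- a.1 + (b * p)%:Z, - a.2 + (c * q)%:Z) = F`_q`_p.
Proof.
rewrite /mono_coef big_map /=.
transitivity (\sum_(d <- support_grid F | d == (p, q)) F`_d.2`_d.1).
  apply: eq_bigl => -[p' q']; rewrite !xpair_eqE /= !(inj_eq (addrI _)) !eqz_nat.
  by rewrite !eqn_pmul2l.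
rewrite (sum_seq_pred1 _ (fun d => F`_d.2`_d.1) (support_grid_uniq F)) /=.
case: ifPn => // ns; apply/esym/eqP; apply: contraNT ns.
exact: mem_support_grid.
Qed.

Lemma mono_coef_laurent_neq0 a F d : mono_coef (laurent_mono a F) d != 0 ->
  exists p q : nat, d = (- a.1 + (b * p)%:Z, - a.2 + (c * q)%:Z).
Proof.
move=> nz; have /mapP[x /mapP[[p q] _ ->] ->] : d \in [seq x.2 | x <- laurent_mono a F].
  apply: contraNT nz => nin; rewrite /mono_coef big_seq_cond big1 // => x /andP[xs /eqP e].
  by case/negP: nin; rewrite -e map_f.
by exists p, q.
Qed.

Lemma mono_coef_laurent_ge0 a F d : (forall p q, 0 <= F`_q`_p) ->
  0 <= mono_coef (laurent_mono a F) d.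
Proof.
move=> F0; have [->//|/mono_coef_laurent_neq0[p [q ->]]] := eqVneq (mono_coef (laurent_mono a F) d) 0.
by rewrite mono_coef_laurent.
Qed.

Lemma greedy_poly_ge0 (a1 a2 : nat) p q : 0 <= (greedy_poly b c a1 a2)`_q`_p.
Proof.
rewrite coef_dyck_poly coef_sum; apply: sumr_ge0 => A _; rewrite coef_sum.
by apply: sumr_ge0 => B _; rewrite coefXn ler0n.
Qed.

Lemma greedy_poly00 (a1 a2 : nat) : (greedy_poly b c a1 a2)`_0`_0 = 1.
Proof.
have [d0 -> _] := greedy_row b a1 a2 c_gt0.
by rewrite coef0_pow1X_mul d0 coefC.
Qed.

Lemma binz_sum (x : int) k (u : nat -> int) p :
  \sum_(1 <= i < p.+1) (-1) ^+ (i - 1)%N * u (p - i)%N * binz (x - k%:Z + i%:Z - 1) i =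
  greedy_sum (pos_part x - k) u p.
Proof.
apply: eq_big_nat => i hi; congr (_ * _); rewrite pos_part_subn.
move: (x - k%:Z) => y; have := pos_partE y; move: (pos_part y) => n ny.
have [y0|y0] := lerP y 0.
  have -> : n = 0%N by lia.
  rewrite bin_small; last by lia.
  by case e : (y + i%:Z - 1) => [m|//] /=; rewrite bin_small //; lia.
have -> : y + i%:Z - 1 = (n + i - 1)%N%:Z by lia.
by [].
Qed.

Definition greedy_coef_poly a := greedy_poly b c (pos_part a.1) (pos_part a.2).

Lemma greedy_coef_max a p q : (p, q) != (0, 0)%N ->
  (greedy_coef_poly a)`_q`_p = Num.max
    (greedy_sum (pos_part a.2 - c * q) (fun i => (greedy_coef_poly a)`_q`_i) p)
    (greedy_sum (pos_part a.1 - b * p) (fun i => (greedy_coef_poly a)`_i`_p) q).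
Proof.
apply: factor_greedy (greedy_row _ _ _ c_gt0) _ (greedy_col _ _ _ b_gt0) _ => //.
  by move=> *; apply: row_quotient_ge0.
by move=> *; apply: row_quotient_ge0.
Qed.

Lemma greedy_recurrenceE a (C : {fsfun nat * nat -> int with 0}) :
  greedy_recurrence b c a C <-> forall p q, (p, q) != (0, 0)%N ->
  C (p, q) = Num.max (greedy_sum (pos_part a.2 - c * q) (fun i => C (i, q)) p)
                     (greedy_sum (pos_part a.1 - b * p) (fun i => C (p, i)) q).
Proof.
split=> h p q nz; rewrite h // -!binz_sum; congr Num.max; apply: eq_bigr => k _;
  by rewrite PoszM.
Qed.

Lemma greedy_recurrence_unique a (C : {fsfun nat * nat -> int with 0}) :
  C (0, 0)%N = 1 -> greedy_recurrence b c a C ->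
  forall p q, C (p, q) = (greedy_coef_poly a)`_q`_p.
Proof.
move=> C0 /greedy_recurrenceE rec.
suff h n p q : (p + q < n)%N -> C (p, q) = (greedy_coef_poly a)`_q`_p.
  by move=> p q; apply: (h (p + q).+1).
elim: n p q => // n IH p q pq.
have [[-> ->]|nz] := eqVneq (p, q) (0, 0)%N; first by rewrite C0 greedy_poly00.
rewrite rec // greedy_coef_max //; congr Num.max; apply: greedy_sum_eq => i ip; apply: IH; lia.
Qed.

Lemma pointed_sum a F (C : {fsfun nat * nat -> int with 0}) (u v : ratfun) :
  (forall p q, C (p, q) = F`_q`_p) ->
  u ^ (- a.1) * v ^ (- a.2) * (\sum_(d <- finsupp C) (C d)%:~R * u ^+ (b * d.1) * v ^+ (c * d.2)) =
  laurent_at b c a F u v.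
Proof.
move=> CF; rewrite /laurent_at ev2_grid; congr (_ * _).
pose f (d : nat * nat) : ratfun := u ^+ b ^+ d.1 * v ^+ c ^+ d.2.
transitivity (\sum_(d <- finsupp C) f d *~ C d).
  by apply: eq_bigr => d _; rewrite -[RHS]mulrzl /f !exprM mulrA.
rewrite (sum_finsupp f (support_grid_uniq F)); first by apply: eq_bigr => -[p q] _; rewrite CF.
by move=> [p q]; rewrite mem_finsupp CF => /mem_support_grid.
Qed.

Lemma greedy_atP m a f : greedy_at b c m a f <-> f = greedy_in b c m a.
Proof.
split=> [[C [[_ C0 ->] rec]]|->].
  rewrite -[RHS]/(laurent_at b c a (greedy_coef_poly a) _ _).
  exact: pointed_sum (greedy_recurrence_unique C0 rec).
pose F := greedy_coef_poly a.
pose C : {fsfun nat * nat -> int with 0} :=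
  [fsfun d in [fset d in support_grid F]%fset => F`_d.2`_d.1 | 0].
have CF p q : C (p, q) = F`_q`_p.
  rewrite fsfunE inE /=; case: ifPn => // ns; apply/esym/eqP; apply: contraNT ns.
  exact: mem_support_grid.
exists C; split; first split.
- exact: greedy_in_ca.
- by rewrite CF greedy_poly00.
- by rewrite (pointed_sum a _ _ CF).
apply/greedy_recurrenceE => p q nz; rewrite CF greedy_coef_max //.
by congr Num.max; apply: greedy_sum_eq => i _; rewrite CF.
Qed.

Lemma greedy_in_mono m a : greedy_in b c m a =
  mono_sum (laurent_mono a (greedy_coef_poly a)) (odd_var b c m) (even_var b c m).
Proof. by rewrite mono_sum_laurent ?cluster_var_neq0. Qed.

Lemma greedy_in_positive_at m a : positive_at b c m (greedy_in b c m a).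
Proof.
rewrite greedy_in_mono; set s := laurent_mono _ _.
have s0 d : 0 <= mono_coef s d by apply: mono_coef_laurent_ge0 => *; apply: greedy_poly_ge0.
have pos t : (forall d, 0 <= mono_coef t d) ->
    forall d, d \in finsupp (fsfun_of_mono t) -> 0 < fsfun_of_mono t d.
  by move=> t0 d; rewrite mem_finsupp fsfun_of_monoE lt_def t0 andbT.
rewrite /odd_var /even_var; case: odd_int.
  exists (fsfun_of_mono s); split; last exact: pos.
  by rewrite laurent_eval_fsfun_of_mono.
exists (fsfun_of_mono (mono_swap s)); split.
  by rewrite laurent_eval_fsfun_of_mono mono_sum_swap.
by apply: pos => -[i j]; rewrite mono_coef_swap.
Qed.

Lemma initial_inj : ev_injective (cluster_var b c 1) (cluster_var b c 2).
Proof. exact: ev2_initial_inj. Qed.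

Lemma greedy_in_positive a : positive_elt b c (greedy_in b c 1 a).
Proof.
split; first exact: greedy_in_ca.
  apply/eqP; rewrite greedy_in_mono => e.
  have nil0 : mono_sum [::] (cluster_var b c 1) (cluster_var b c 2) = 0 by rewrite /mono_sum big_nil.
  rewrite -nil0 in e.
  have := mono_sum_inj initial_inj (cluster_var_neq0 b c 1) (cluster_var_neq0 b c 2) e.
  move/(_ (- a.1 + (b * 0)%:Z, - a.2 + (c * 0)%:Z)).
  by rewrite mono_coef_laurent greedy_poly00 /mono_coef big_nil.
move=> m; have [a' ->] := greedy_in_any b_gt0 c_gt0 1 m a.
exact: greedy_in_positive_at.
Qed.

End LaurentExpansion.

(** * Indecomposability, independence and the theorem *)

Lemma mono_coef_of_ge0 (L : {fsfun int * int -> int with 0}) d :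
  (forall d, d \in finsupp L -> 0 < L d) -> 0 <= L d.
Proof.
by move=> pos; case: (boolP (d \in finsupp L)) => [/pos/ltW|/fsfun_dflt ->].
Qed.

Section Exchange.

Variables (K : fieldType) (u v : K) (b : nat).
Variables (s s0 : seq (int * (int * int))).
Hypotheses (inj : ev_injective u v) (u_neq0 : u != 0) (v_neq0 : v != 0).
Hypotheses (b_gt0 : (0 < b)%N) (t_neq0 : 1 + u ^+ b != 0).
Hypothesis same : mono_sum s u v = mono_sum s0 u ((1 + u ^+ b) / v).

(** Substituting (1 + u^b) / v for the new variable and multiplying by
    (1 + u^b)^N u^N v^N gives an identity of polynomials; comparing the terms in
    v^-n shows that (1 + u^b)^n times one row of the new expansion is a row of the
    old one. *)
Lemma exchange_coef (n N : nat) : (mono_bound s + mono_bound s0 + n <= N)%N ->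
  exists E : {poly int}, (forall i, E`_i = mono_coef s0 (i%:Z - N%:Z, n%:Z)) /\
    (forall i, ((1 + 'X^b) ^+ n * E)`_i = mono_coef s (i%:Z - N%:Z, - n%:Z)).
Proof.
move=> le; have sN : (mono_bound s <= N)%N by lia.
have s0N : (mono_bound s0 <= N)%N by lia.
pose T : {poly int} := 1 + 'X^b.
have T0 : T != 0.
  apply/eqP => /(congr1 (fun P : {poly int} => P`_0)).
  by rewrite coefD coefC coefXn coef0 (ltn_eqF b_gt0) addr0 => /eqP; rewrite oner_eq0.
pose G0 : {poly {poly int}} := \sum_(x <- s0) x.1%:P%:P *
  ('X^(absz (N%:Z - x.2.2)) * (T ^+ absz (N%:Z + x.2.2) * 'X^(absz (N%:Z + x.2.1)))%:P).
have evT : ev1 u T = 1 + u ^+ b by rewrite rmorphD rmorph1 rmorphXn /= ev1X.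
have eG : (T ^+ N)%:P * mono_poly N s = G0.
  apply/eqP; rewrite -subr_eq0; apply/eqP/inj; rewrite rmorphB rmorphM /= ev2C rmorphXn /= evT.
  rewrite ev2_mono_poly // same raddf_sum /mono_sum !mulr_sumr.
  apply/eqP; rewrite subr_eq0; apply/eqP.
  rewrite big_seq_cond [RHS]big_seq_cond; apply: eq_bigr => x; rewrite andbT => /mono_boundP h.
  have hu : (`|x.2.1| <= N)%N by apply: leq_trans (leq_trans (leq_addr _ _) h) s0N.
  have hv : (`|x.2.2| <= N)%N by apply: leq_trans (leq_trans (leq_addl _ _) h) s0N.
  have hv' : (`|- x.2.2| <= N)%N by rewrite abszN.
  rewrite [RHS]rmorphM /= ev2C [X in _ = _ * X]rmorphM /= rmorphXn /= ev2X ev2C.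
  rewrite [X in _ = _ * (_ * X)]rmorphM !rmorphXn /= evT ev1X.
  rewrite [ev1 _ _%:P]/ev1 /= map_polyC /horner_eval hornerC /=.
  by rewrite !exprz_shift // expfzMl exprz_inv; ring.
exists (\sum_(x <- s0 | x.2.2 == n%:Z) x.1%:P * 'X^(absz (N%:Z + x.2.1))).
set E := \sum_(_ <- _ | _) _.
have EE i : E`_i = mono_coef s0 (i%:Z - N%:Z, n%:Z).
  rewrite /E /mono_coef coef_sum big_mkcond [RHS]big_mkcond /=.
  rewrite big_seq_cond [RHS]big_seq_cond; apply: eq_bigr => x; rewrite andbT => /mono_boundP h.
  case: x h => z [d1 d2] /= h; rewrite xpair_eqE.
  have -> : (d1 == i%:Z - N%:Z) = (i == absz (N%:Z + d1)) by lia.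
  case: (d2 == _); rewrite ?andbF // andbT coefCM coefXn.
  by case: (i == _); rewrite ?mulr1 ?mulr0.
split=> // i.
have -> : mono_coef s (i%:Z - N%:Z, - n%:Z) = (mono_poly N s)`_(N - n)`_i.
  by rewrite coef_mono_poly //; congr (mono_coef s (_, _)); lia.
suff <- : T ^+ n * E = (mono_poly N s)`_(N - n) by [].
apply: (mulfI (expf_neq0 N T0)).
rewrite -coefCM eG coef_sum -/T mulrA -exprD /E mulr_sumr [LHS]big_mkcond /=.
rewrite big_seq_cond [RHS]big_seq_cond; apply: eq_bigr => x; rewrite andbT => /mono_boundP h.
rewrite coefCM coefMC coefXn; case: x h => z [d1 d2] /= h.
have -> : ((N - n)%N == absz (N%:Z - d2)) = (d2 == n%:Z) by lia.
case: eqP => [->|_]; last by rewrite mul0r mulr0.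
by rewrite mul1r mulrCA.
Qed.

(** The coefficients of the quotient of a row by (1 + u^b)^n are coefficients of the
    expansion at the next cluster, hence nonnegative; they are also the differences
    between the coefficients of the row and the sums of the greedy recurrence. *)
Lemma exchange_lower (n : nat) (a : int) (p : nat) :
  (forall d, 0 <= mono_coef s0 d) ->
  (forall i, mono_coef s (i, - n%:Z) != 0 -> - a <= i) ->
  greedy_sum n (fun i => mono_coef s (- a + (b * i)%:Z, - n%:Z)) p <=
  mono_coef s (- a + (b * p)%:Z, - n%:Z).
Proof.
move=> pos low; rewrite -subr_ge0 greedy_sum_negbin.
have [N [leN aN]] : exists N, (mono_bound s + mono_bound s0 + n <= N)%N /\ (absz a <= N)%N.
  by exists (mono_bound s + mono_bound s0 + n + absz a)%N; lia.
have [E [EE PE]] := exchange_coef leN.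
(* The position of the exponent b p - a after the shift by N. *)
have [j ej] : exists j : nat, j%:Z = N%:Z - a + (b * p)%:Z.
  by exists (absz (N%:Z - a + (b * p)%:Z)); lia.
have pj : (p < j.+1)%N by have : (p <= b * p)%N by [rewrite leq_pmull]; lia.
have := pos (j%:Z - N%:Z, n%:Z); rewrite -EE (coef_quotient n E b_gt0 (ltnSn j)).
rewrite (big_ord_widen j.+1 (fun k => negbin n k * mono_coef s (- a + (b * (p - k))%:Z, - n%:Z))) //.
rewrite [X in _ -> 0 <= X]big_mkcond /=; congr (is_true (0 <= _)).
apply: eq_bigr => k _; case: ltnP => kp.
  have bk : (b * (p - k) + b * k = b * p)%N by rewrite -mulnDr subnK.
  rewrite PE ifT; last by lia.
  congr (_ * mono_coef s (_, _)); move: bk ej.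
  by move: (b * (p - k))%N (b * k)%N (b * p)%N => y z w *; lia.
case: ifP => h; last by rewrite mulr0.
rewrite PE.
case: (eqVneq (mono_coef s ((j - b * k)%N%:Z - N%:Z, - n%:Z)) 0) => [->|/low].
  by rewrite mulr0.
have : (b * p.+1 <= b * k)%N by rewrite leq_mul2l kp orbT.
by rewrite mulnS; lia.
Qed.

End Exchange.

Section Indecomposable.

Variables b c : nat.
Hypotheses (b_gt0 : (0 < b)%N) (c_gt0 : (0 < c)%N).

Local Notation x_ := (cluster_var b c).

(** Induction on p + q: the coefficients of g are at most those of the greedy element,
    and at least both sums of the recurrence, which by induction are the sums for the
    greedy element. *)
Lemma summand_zero a g h L L' : positive_elt b c g -> greedy_in b c 1 a = g + h ->
  g = laurent_eval L (x_ 1) (x_ 2) -> (forall d, 0 <= L d) ->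
  h = laurent_eval L' (x_ 1) (x_ 2) -> (forall d, 0 <= L' d) ->
  L (- a.1, - a.2) = 1 -> h = 0.
Proof.
move=> [_ _ pos_g] fgh gL L0 hL' L0' La.
have nz1 := cluster_var_neq0 b c 1; have nz2 := cluster_var_neq0 b c 2.
pose F := greedy_coef_poly b c a; pose s := laurent_mono b c a F.
have inj : ev_injective (x_ 1) (x_ 2) by exact: ev2_initial_inj.
have sL d : mono_coef s d = L d + L' d.
  rewrite -(mono_coef_of L) -(mono_coef_of L') -mono_coef_cat.
  apply: (mono_sum_inj inj nz1 nz2); rewrite mono_sum_cat !mono_sum_of -gL -hL' -fgh.
  by rewrite [in RHS]greedy_in_mono.
have Lle d : L d <= mono_coef s d by rewrite sL lerDl.
have lattice d : L d != 0 -> exists p q : nat, d = (- a.1 + (b * p)%:Z, - a.2 + (c * q)%:Z).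
  move=> Ld; apply: (@mono_coef_laurent_neq0 b c a F).
  by have := Lle d; have := L0 d; rewrite -/s; move: Ld; lia.
pose gamma (p q : nat) := L (- a.1 + (b * p)%:Z, - a.2 + (c * q)%:Z).
have lower1 p q : greedy_sum (pos_part a.2 - c * q) (fun i => gamma i q) p <= gamma p q.
  rewrite pos_part_subn; have := pos_partE (a.2 - (c * q)%:Z).
  move: (pos_part _) => n en; have [le|lt] := leP 0 (a.2 - (c * q)%:Z); last first.
    by have -> : n = 0%N; [lia | rewrite greedy_sum0 /gamma L0].
  have [L1 [gL1 pos1]] := pos_g 0; rewrite add0r in gL1.
  have x0E : x_ 0 = (1 + x_ 1 ^+ b) / x_ 2.
    by rewrite addrC -(exchange_relation b c 1) mulfK.
  have same : mono_sum (mono_of L) (x_ 1) (x_ 2) =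
      mono_sum (mono_swap (mono_of L1)) (x_ 1) ((1 + x_ 1 ^+ b) / x_ 2).
    by rewrite mono_sum_swap !mono_sum_of -x0E -gL -gL1.
  have t0 : 1 + x_ 1 ^+ b != 0 := exchange_add b c 1.
  have := @exchange_lower _ _ _ _ _ _ inj nz1 nz2 b_gt0 t0 same n a.1 p.
  have e : - n%:Z = - a.2 + (c * q)%:Z by lia.
  rewrite e (@greedy_sum_eq _ _ (fun i => gamma i q)) => [|i _]; last by rewrite mono_coef_of.
  rewrite mono_coef_of; apply.
    by move=> [i j]; rewrite mono_coef_swap mono_coef_of; apply: mono_coef_of_ge0.
  by move=> i; rewrite mono_coef_of => /lattice[p' [q' [-> _]]]; lia.
have lower2 p q : greedy_sum (pos_part a.1 - b * p) (fun i => gamma p i) q <= gamma p q.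
  rewrite pos_part_subn; have := pos_partE (a.1 - (b * p)%:Z).
  move: (pos_part _) => n en; have [le|lt] := leP 0 (a.1 - (b * p)%:Z); last first.
    by have -> : n = 0%N; [lia | rewrite greedy_sum0 /gamma L0].
  have [L1 [gL1 pos1]] := pos_g 2.
  have x3E : x_ 3 = (1 + x_ 2 ^+ c) / x_ 1.
    by rewrite addrC -(exchange_relation b c 2) mulrC mulKf.
  have same : mono_sum (mono_swap (mono_of L)) (x_ 2) (x_ 1) =
      mono_sum (mono_of L1) (x_ 2) ((1 + x_ 2 ^+ c) / x_ 1).
    by rewrite mono_sum_swap !mono_sum_of -x3E -gL -gL1.
  have t0 : 1 + x_ 2 ^+ c != 0 := exchange_add b c 2.
  have inj' : ev_injective (x_ 2) (x_ 1).
    by move=> G; rewrite -ev2_swap => /inj/eqP; rewrite swapXY_eq0 => /eqP.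
  have := @exchange_lower _ _ _ _ _ _ inj' nz2 nz1 c_gt0 t0 same n a.2 q.
  have e : - n%:Z = - a.1 + (b * p)%:Z by lia.
  rewrite e (@greedy_sum_eq _ _ (fun i => gamma p i)) => [|i _]; last first.
    by rewrite mono_coef_swap mono_coef_of.
  rewrite mono_coef_swap mono_coef_of; apply.
    by move=> d; rewrite mono_coef_of; apply: mono_coef_of_ge0.
  by move=> i; rewrite mono_coef_swap mono_coef_of => /lattice[p' [q' [_ ->]]]; lia.
have gamF n : forall p q, (p + q < n)%N -> gamma p q = F`_q`_p.
  elim: n => // n IH p q pq; have [[-> ->]|nz] := eqVneq (p, q) (0, 0)%N.
    by rewrite /gamma !muln0 !addr0 La greedy_poly00.
  apply/eqP; rewrite eq_le; apply/andP; split.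
    by have := Lle (- a.1 + (b * p)%:Z, - a.2 + (c * q)%:Z); rewrite mono_coef_laurent.
  rewrite greedy_coef_max // ge_max; apply/andP; split.
    by rewrite (@greedy_sum_eq _ _ (fun i => gamma i q)) // => i ip; rewrite IH //; lia.
  by rewrite (@greedy_sum_eq _ _ (fun i => gamma p i)) // => i ip; rewrite IH //; lia.
have L'0 d : L' d = 0.
  have := L0' d; have := L0 d; have := sL d.
  have [-> ? ? ?|/mono_coef_laurent_neq0[p [q ->]]] := eqVneq (mono_coef s d) 0; first by lia.
  by rewrite (mono_coef_laurent b_gt0 c_gt0 a F p q) -(gamF (p + q).+1 p q) // /gamma; lia.
by rewrite hL' /laurent_eval big1 // => d _; rewrite L'0 !mul0r.
Qed.

Lemma greedy_in_indecomposable a : indecomposable_positive b c (greedy_in b c 1 a).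
Proof.
split; first exact: greedy_in_positive.
move=> [g [h [pg ph fgh]]].
have [_ g0 pos_g] := pg; have [_ h0 pos_h] := ph.
have [L [gL posL]] := pos_g 1; have [L' [hL' posL']] := pos_h 1.
have L0 d : 0 <= L d := mono_coef_of_ge0 d posL.
have L0' d : 0 <= L' d := mono_coef_of_ge0 d posL'.
have sum1 : L (- a.1, - a.2) + L' (- a.1, - a.2) = 1.
  rewrite -(mono_coef_of L) -(mono_coef_of L') -mono_coef_cat.
  have -> : 1 = (greedy_coef_poly b c a)`_0`_0 by rewrite greedy_poly00.
  rewrite -(mono_coef_laurent b_gt0 c_gt0 a) !muln0 !addr0.
  apply: (mono_sum_inj (@ev2_initial_inj) (cluster_var_neq0 b c 1) (cluster_var_neq0 b c 2)).
  rewrite mono_sum_cat !mono_sum_of -gL -hL' -fgh.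
  by rewrite [in LHS]greedy_in_mono.
have [La|La] : L (- a.1, - a.2) = 1 \/ L' (- a.1, - a.2) = 1.
  by have := L0 (- a.1, - a.2); have := L0' (- a.1, - a.2); lia.
  by move/eqP: h0; apply; apply: (summand_zero pg fgh gL L0 hL' L0' La).
rewrite addrC in fgh.
by move/eqP: g0; apply; apply: (summand_zero ph fgh hL' L0' gL L0 La).
Qed.

End Indecomposable.

Section Basis.

Variables b c : nat.
Hypotheses (b_gt0 : (0 < b)%N) (c_gt0 : (0 < c)%N).

Definition mono_scale (z : int) (s : seq (int * (int * int))) :=
  [seq (z * x.1, x.2) | x <- s].

Lemma mono_sum_scale (K : fieldType) (u v : K) z s :
  mono_sum (mono_scale z s) u v = mono_sum s u v *~ z.
Proof.
rewrite /mono_sum big_map -mulrzl mulr_sumr; apply: eq_bigr => x _ /=.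
by rewrite intrM !mulrA.
Qed.

Lemma mono_coef_scale z s d : mono_coef (mono_scale z s) d = z * mono_coef s d.
Proof. by rewrite /mono_coef big_map mulr_sumr. Qed.

Lemma seq_max_key (T : eqType) (key : T -> int) (s : seq T) : s != [::] ->
  exists2 x, x \in s & forall y, y \in s -> key y <= key x.
Proof.
elim: s => // x s IH _; have [->|/IH[y ys ymax]] := eqVneq s [::].
  by exists x => [|y]; rewrite inE // => /eqP->.
have [le|/ltW le] := lerP (key x) (key y).
  exists y => [|z]; rewrite inE ?ys ?orbT // => /orP[/eqP->//|]; exact: ymax.
exists x => [|z]; rewrite inE ?eqxx // => /orP[/eqP->//|/ymax/le_trans]; exact.
Qed.

(** Among the indices where the coefficients differ, take one with a1 + a2 maximal:
    no other greedy element involved contains the monomial x1^-a1 x2^-a2. *)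
Lemma greedy_independent (n n' : {fsfun int * int -> int with 0}) :
  \sum_(a <- finsupp n) greedy_in b c 1 a *~ n a =
  \sum_(a <- finsupp n') greedy_in b c 1 a *~ n' a -> n = n'.
Proof.
move=> same; pose D := undup (finsupp n ++ finsupp n').
have uD : uniq D by apply: undup_uniq.
have nD : {subset finsupp n <= D} by move=> a; rewrite mem_undup mem_cat => ->.
have nD' : {subset finsupp n' <= D} by move=> a; rewrite mem_undup mem_cat orbC => ->.
rewrite (sum_finsupp _ uD nD) (sum_finsupp _ uD nD') in same.
pose lm a := laurent_mono b c a (greedy_coef_poly b c a).
pose S (k : {fsfun int * int -> int with 0}) := flatten [seq mono_scale (k a) (lm a) | a <- D].
have sumS k : mono_sum (S k) (cluster_var b c 1) (cluster_var b c 2) =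
    \sum_(a <- D) greedy_in b c 1 a *~ k a.
  rewrite /mono_sum big_flatten big_map; apply: eq_bigr => a _.
  by rewrite -/(mono_sum _ _ _) mono_sum_scale [in RHS]greedy_in_mono.
have coefS k d : mono_coef (S k) d = \sum_(a <- D) k a * mono_coef (lm a) d.
  rewrite /mono_coef big_flatten big_map; apply: eq_bigr => a _.
  exact: mono_coef_scale.
have eqS : mono_coef (S n) =1 mono_coef (S n').
  apply: (mono_sum_inj (@ev2_initial_inj) (cluster_var_neq0 b c 1) (cluster_var_neq0 b c 2)).
  by rewrite !sumS.
apply/fsfunP => a1; apply/eqP/negPn/negP => ne1.
pose bad := [seq a <- D | n a != n' a].
have bad1 : a1 \in bad.
  rewrite mem_filter ne1 mem_undup mem_cat !mem_finsupp /=.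
  by apply: contraR ne1; rewrite negb_or !negbK => /andP[/eqP-> /eqP->].
have bad0 : bad != [::] by apply: contraTneq bad1 => ->.
have [a0 a0bad a0max] := seq_max_key (fun a : int * int => a.1 + a.2) bad0.
move: a0bad; rewrite mem_filter => /andP[ne0 a0D].
have := eqS (- a0.1, - a0.2); rewrite !coefS => /eqP; rewrite -subr_eq0 -sumrB.
rewrite (bigD1_seq a0) //= big1_seq => [|a /andP[aa0 aD]]; last first.
  rewrite -mulrBl; have [->|ne] := eqVneq (n a) (n' a); first by rewrite subrr mul0r.
  have /a0max le : a \in bad by rewrite mem_filter ne.
  have [->|/mono_coef_laurent_neq0[p [q []]]] := eqVneq (mono_coef (lm a) (- a0.1, - a0.2)) 0.
    by rewrite mulr0.
  move=> e1 e2; case/eqP: aa0; case: a a0 le e1 e2 {aD ne a0max ne0 a0D} => [i j] [i0 j0] /= *.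
  by congr (_, _); lia.
rewrite addr0 -mulrBl mulf_eq0 subr_eq0 (negbTE ne0) /=.
have := mono_coef_laurent b_gt0 c_gt0 a0 (greedy_coef_poly b c a0) 0 0.
by rewrite !muln0 !addr0 -/(lm a0) => ->; rewrite greedy_poly00.
Qed.

Lemma greedy_basis : Zbasis_of_cluster_algebra b c (greedy_in b c 1).
Proof.
split=> [a|f /(ca_greedy_span b_gt0 c_gt0)[s fs]]; first exact: greedy_in_ca.
have fE : f = \sum_(a <- finsupp (fsfun_of_mono s)) greedy_in b c 1 a *~ fsfun_of_mono s a.
  rewrite (sum_finsupp (greedy_in b c 1) (undup_uniq _) (@finsupp_fsfun_of_mono s)).
  under eq_bigr => d _ do rewrite fsfun_of_monoE.
  rewrite -mono_regroup fs; apply: eq_bigr => x _; exact: mulrzl.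
by exists (fsfun_of_mono s); split=> // n fn; apply: greedy_independent; rewrite -fE -fn.
Qed.

End Basis.

Theorem theorem1p7 (b c : nat) (hb : (0 < b)%N) (hc : (0 < c)%N) :
  exists x : int * int -> ratfun,
    [/\ forall a : int * int, unique (greedy_at b c 1 a) (x a),
        forall a : int * int, indecomposable_positive b c (x a),
        Zbasis_of_cluster_algebra b c x,
        forall (m n : int) (f : ratfun),
          (exists a : int * int, greedy_at b c m a f) <->
          (exists a : int * int, greedy_at b c n a f) &
        forall (m : int) (d1 d2 : nat),
          exists a : int * int,
            x a = cluster_var b c m ^+ d1 * cluster_var b c (m + 1) ^+ d2].
Proof.
have change m n f : (exists a, greedy_at b c m a f) -> exists a, greedy_at b c n a f.
  case=> a /(greedy_atP hb hc) ->; have [a' ->] := greedy_in_any hb hc m n a.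
  by exists a'; apply/(greedy_atP hb hc).
exists (greedy_in b c 1); split.
- by move=> a; split=> [|f /(greedy_atP hb hc) ->//]; apply/(greedy_atP hb hc).
- exact: greedy_in_indecomposable.
- exact: greedy_basis.
- by move=> m n f; split; apply: change.
move=> m d1 d2; have [a ->] := cluster_monomial_greedy b hc m d1 d2.
by have [a' ->] := greedy_in_any hb hc m 1 a; exists a'.
Qed.
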